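(* Let $\Lambda\in\mathcal{L}$, $c\in C^0_\Lambda$ and $\epsilon\in\{1,-1\}$. Write $w_0=w_0^c\,w_{0,c}$ with $w_0^c\in W^c$ and $w_{0,c}\in W_c$. There is a bijection $\phi_{c,\epsilon}:\mathbb{F}[\widetilde{\mathcal{O}}_{\Lambda,c}]^{\epsilon\text{-sym}}\to\mathbb{F}[\Lambda]^{\epsilon,J_c\text{-sym}}$ defined by $$\phi_{c,\epsilon}(f)=\frac{t(w_{0,c})}{t(w_0)}\begin{cases}w_0\gamma^{qp}_{w_0^c}(f),&\epsilon=1,\\ \iota w_0\gamma^{qp}_{w_0^c}(f),&\epsilon=-1,\end{cases}$$ and its inverse is given by $$\phi_{c,\epsilon}^{-1}(p)=t(w_0)\begin{cases}\sum_{w\in W^c}\big[w_0\,\pi(T_{(w_0w)^{-1}}^{-1})\,p\big]x^{wc},&\epsilon=1,\\[2pt] \sum_{w\in W^c}\big[(-1)^{l(w_0)+l(w)}\,\iota w_0\,\pi(T_{w_0w})\,p\big]x^{wc},&\epsilon=-1.\end{cases}$$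
   Context: Let $E$ be a Euclidean space with dual $E^*$ and $\Phi\subset E^*$ a reduced irreducible root system (in its span). For $\alpha\in\Phi$, $\alpha^\vee\in E$ is the vector with $\langle y,\alpha^\vee\rangle=2\alpha(y)/\|\alpha\|^2$ for all $y\in E$. Fix simple roots $\alpha_1,\dots,\alpha_r$ and positive roots $\Phi^+$; $W$ is the finite Weyl group, with simple reflections $s_i$, acting on $E$ by $s_\alpha(y)=y-\alpha(y)\alpha^\vee$; $l$ is the length, $w_0$ the longest element. $Q^\vee$ is the coroot lattice. $\mathcal{L}$ is the set of finitely generated abelian subgroups $\Lambda\subset E$ with $Q^\vee\subseteq\Lambda$ and $\alpha(\Lambda)\subseteq\mathbb{Z}$ for all $\alpha\in\Phi$. $\mathbb{F}$ is a field; $\mathbb{F}[E]$ is the group algebra with basis $x^y$ ($y\in E$), and $\mathbb{F}[S]$ is the span of $x^y$, $y\in S$; $W$ acts by $wx^y=x^{wy}$; $\iota$ is the linear map $x^y\mapsto x^{-y}$. $\widetilde W_\Lambda=W\ltimes\Lambda$ acts on $E$ with $\Lambda$ acting by translations. $\overline{C^+}=\{y\in E:0\le\alpha(y)\le1\ \forall\alpha\in\Phi^+\}$. $C^0_\Lambda$ is the set of $c\in\overline{C^+}$ whose stabilizer in $\widetilde W_\Lambda$ equals its stabilizer $W_c$ in $W$. $J_c=\{j:s_jc=c\}$, $W_c=\langle s_j:j\in J_c\rangle$; $W^c$ is the set of minimal length representatives of $W/W_c$. $\widetilde{\mathcal{O}}_{\Lambda,c}=\{\lambda+wc:\lambda\in\Lambda,w\in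 W\}$. For $c\in C^0_\Lambda$, $\mathbb{F}[\widetilde{\mathcal{O}}_{\Lambda,c}]$ is a free $\mathbb{F}[\Lambda]$-module with basis $x^{wc}$ ($w\in W^c$), and $\gamma^{qp}_w$ is defined by $f=\sum_{w\in W^c}\gamma_w^{qp}(f)x^{wc}$. Fix a $W$-invariant map $\Phi\to\mathbb{F}^\times$, $\alpha\mapsto t_\alpha$; $t_j=t_{\alpha_j}$, and $t(w)=t_{j_1}\cdots t_{j_k}$ for a reduced expression $w=s_{j_1}\cdots s_{j_k}$. For $f\in\mathbb{F}[\Lambda]$, $\nabla_j(f)=\frac{s_jf-f}{x^{\alpha_j^\vee}-1}$. The extended affine Hecke algebra $\widetilde{\mathcal{H}}_\Lambda$ is generated by $T_1,\dots,T_r$ and $x^\lambda$ ($\lambda\in\Lambda$) with: braid relations; $(T_j-t_j)(T_j+t_j^{-1})=0$; $x^\lambda x^\mu=x^{\lambda+\mu}$, $x^0=1$; $T_jx^\lambda-x^{s_j\lambda}T_j=(t_j-t_j^{-1})\nabla_j(x^\lambda)$. $T_w=T_{j_1}\cdots T_{j_k}$ for a reduced expression. Polynomial representation $\pi$ on $\mathbb{F}[\Lambda]$: $\pi(T_j)f=t_js_jf+(t_j-t_j^{-1})\nabla_j(f)$, $\pi(x^\mu)$ multiplication by $x^\mu$. Quasi-polynomial representation $\pi^{qp}$ on $\mathbb{F}[E]$ (preserving $\mathbb{F}[\widetilde{\mathcal{O}}_{\Lambda,c}]$): $\pi^{qp}(x^\lambda)x^y=x^{\lambda+y}$ and $\pi^{qp}(T_j)x^y=\chi_j(\alpha_j(y))x^{s_jy}+(t_j-t_j^{-1})\frac{x^{y-\lfloor\alpha_j(y)\rfloor\alpha_j^\vee}-x^y}{x^{\alpha_j^\vee}-1}$,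 where $\chi_j(a)=t_j$ if $a\in\mathbb{Z}$ and $\chi_j(a)=1$ otherwise. $\mathbb{F}[\widetilde{\mathcal{O}}_{\Lambda,c}]^{\epsilon\text{-sym}}$ is the space of $\epsilon$-symmetric quasi-polynomials, i.e. $f\in\mathbb{F}[\widetilde{\mathcal{O}}_{\Lambda,c}]$ with $\pi^{qp}(T_i)f=\epsilon t_i^\epsilon f$ for all $1\le i\le r$. $\mathbb{F}[\Lambda]^{\epsilon,J_c\text{-sym}}$ is the space of $p\in\mathbb{F}[\Lambda]$ with $\pi(T_j)p=\epsilon t_j^\epsilon p$ for all $j\in J_c$. *)

(* Defs.v *)
From HB Require Import structures.
From mathcomp Require Import all_boot all_order all_algebra finmap.
From mathcomp Require Import boolp classical_sets functions fsbigop reals.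
From mathcomp Require Import sesquilinear.
From mathcomp.multinomials Require Import monalg.

Set Implicit Arguments.
Unset Strict Implicit.
Unset Printing Implicit Defensive.

Import Order.TTheory GRing.Theory Num.Theory.
Local Open Scope classical_set_scope.
Local Open Scope ring_scope.

Definition zspan (V : zmodType) (s : seq V) : set V :=
  [set v | inIntSpan (in_tuple s) v].

(* The group algebra F[E] is {malg F[E]}, the finitely supported functions
   E -> F; the basis element x^y is << y >>.  Since [monalg] only puts a ring
   structure on algebras of monoids without nontrivial units, the convolution
   product of F[E] is given here. *)
Section GroupAlgebra.
Context (F : fieldType) (E : zmodType).
Implicit Types (f g : {malg F[E]}) (S : set E).

Definition gamul f g : {malg F[E]} :=
  \sum_(y <- msupp f) \sum_(z <- msupp g) << f@_y * g@_z *g y + z >>.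

(* the subspace F[S] of F[E] *)
Definition gaspan S : set {malg F[E]} :=
  [set f | forall y, y \in msupp f -> S y].

(* the linear map x^y |-> x^(h y) *)
Definition gamap (h : E -> E) f : {malg F[E]} :=
  \sum_(y <- msupp f) << f@_y *g h y >>.

Definition iota_ga f : {malg F[E]} := gamap -%R f.

(* the linear map x^y |-> X y *)
Definition gaeval (B : lmodType F) (X : E -> B) f : B :=
  \sum_(y <- msupp f) f@_y *: X y.

(* The quotient f / d. All denominators below are of the form x^a - 1 with
   a != 0; they are not zero divisors, so there is at most one quotient. *)
Definition gadiv f d : {malg F[E]} := xget 0 [set g | gamul g d = f].

End GroupAlgebra.

Section RootSystem.
Context (R : realType) (E : vectType R) (dot : {dot E for @idfun R}).
Implicit Types (a b : 'Hom(E, R^o)) (Phi : {fset 'Hom(E, R^o)}).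

(* E^* carries the inner product transported along E ~ E^*. *)
Definition riesz a : E := xget 0 [set v | forall y, dot y v = a y].

Definition ddot a b : R := dot (riesz a) (riesz b).

Definition coroot a : E := xget 0 [set v | forall y, dot y v = 2 * a y / ddot a a].

Definition refl a : 'End(E) := linfun (fun y => y - a y *: coroot a).

Record irreducible_reduced_root_system Phi : Prop := {
  root_neq0 : 0 \notin Phi;
  root_nonempty : Phi != fset0;
  root_refl : forall a b, a \in Phi -> b \in Phi ->
    b - b (coroot a) *: a \in Phi;
  root_int : forall a b, a \in Phi -> b \in Phi -> b (coroot a) \is a Num.int;
  root_reduced : forall a (k : R), a \in Phi -> k *: a \in Phi ->
    k = 1 \/ k = - 1;
  root_irreducible : forall A B : {fset 'Hom(E, R^o)}, Phi = (A `|` B)%fset ->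
    (forall a b, a \in A -> b \in B -> ddot a b = 0) ->
    A = fset0 \/ B = fset0 }.

Definition coroot_lattice Phi : set E := zspan [seq coroot a | a <- Phi].

Definition admissible_lattice Phi (Lam : set E) : Prop :=
  [/\ exists s : seq E, Lam = zspan s,
      coroot_lattice Phi `<=` Lam &
      forall a l, a \in Phi -> Lam l -> a l \is a Num.int].

Definition weyl Phi : set 'End(E) :=
  [set w | exists2 s : seq 'Hom(E, R^o), {subset s <= Phi} &
     w = foldr (fun a v => (refl a \o v)%VF) \1%VF s].

Definition stab Phi (c : E) : set 'End(E) := [set w | weyl Phi w /\ w c = c].

(* The pair (w, l) stands for the element y |-> l + w y of W |x Lam. *)
Definition affine_stab Phi (Lam : set E) (c : E) : set ('End(E) * E) :=
  [set g | [/\ weyl Phi g.1, Lam g.2 & g.2 + g.1 c = c]].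

Definition affine_orbit Phi (Lam : set E) (c : E) : set E :=
  [set y | exists l w, [/\ Lam l, weyl Phi w & y = l + w c]].

Context (r : nat) (al : r.-tuple 'Hom(E, R^o)).

Definition is_base Phi : Prop :=
  [/\ {subset al <= Phi}, free al &
      forall b, b \in Phi -> exists n : 'I_r -> nat,
        b = \sum_(i < r) tnth al i *+ n i \/ b = - \sum_(i < r) tnth al i *+ n i].

Definition pos_root Phi : set 'Hom(E, R^o) :=
  [set b | b \in Phi /\
     exists n : 'I_r -> nat, b = \sum_(i < r) tnth al i *+ n i].

Definition closed_alcove Phi : set E :=
  [set y | forall a, pos_root Phi a -> 0 <= a y <= 1].

Definition C0 Phi (Lam : set E) : set E :=
  [set c | closed_alcove Phi c /\
     affine_stab Phi Lam c = [set g | stab Phi c g.1 /\ g.2 = 0]].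

Definition srefl (i : 'I_r) : 'End(E) := refl (tnth al i).

Definition word_prod (s : seq 'I_r) : 'End(E) :=
  foldr (fun i v => (srefl i \o v)%VF) \1%VF s.

Definition reduced_expr (w : 'End(E)) : set (seq 'I_r) :=
  [set s | word_prod s = w /\
     forall s', word_prod s' = w -> (size s <= size s')%N].

(* Neither T_w nor t(w) below depends on which reduced expression is chosen. *)
Definition red_word (w : 'End(E)) : seq 'I_r := xget [::] (reduced_expr w).

Definition len (w : 'End(E)) : nat := size (red_word w).

Definition is_longest Phi (w0 : 'End(E)) : Prop :=
  weyl Phi w0 /\ forall w, weyl Phi w -> (len w <= len w0)%N.

(* W^c, with W_c = stab Phi c *)
Definition min_reps Phi (c : E) : set 'End(E) :=
  [set w | weyl Phi w /\ forall v, stab Phi c v -> (len w <= len (w \o v)%VF)%N].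

Definition is_order (g : 'End(E)) (m : nat) : Prop :=
  let pow k := iter k (fun h => (g \o h)%VF) \1%VF in
  [/\ (0 < m)%N, pow m = \1%VF &
      forall k, (0 < k < m)%N -> pow k <> \1%VF].

End RootSystem.

(* x y x ... with m factors *)
Fixpoint altprod (B : pzRingType) (m : nat) (x y : B) : B :=
  if m is n.+1 then x * altprod n y x else 1.

(* [rho] restricts to a representation of the algebra [A] on the subspace [U];
   its values outside [U] are irrelevant. *)
Record is_representation (F : fieldType) (A : algType F) (V : lmodType F)
    (U : set V) (rho : A -> V -> V) : Prop := {
  rep_stable : forall h v, U v -> U (rho h v);
  rep_linear : forall h k u v, U u -> U v ->
    rho h (k *: u + v) = k *: rho h u + rho h v;
  rep_linearl : forall k g h v, U v ->
    rho (k *: g + h) v = k *: rho g v + rho h v;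
  rep1 : forall v, U v -> rho 1 v = v;
  repM : forall g h v, U v -> rho (g * h) v = rho g (rho h v) }.

Section Hecke.
Context (R : realType) (E : vectType R) (dot : {dot E for @idfun R}).
Context (Phi : {fset 'Hom(E, R^o)}) (r : nat) (al : r.-tuple 'Hom(E, R^o)).
Context (Lam : set E) (F : fieldType) (t : 'Hom(E, R^o) -> F).

(* b \o w = a means b = w a for the action of W on E^*. *)
Definition invariant_parameter : Prop :=
  (forall a, a \in Phi -> t a != 0) /\
  (forall w a b, weyl dot Phi w -> a \in Phi -> b \in Phi ->
     (b \o w)%VF = a -> t b = t a).

Local Notation s_ i := (srefl dot al i).
Local Notation co_ i := (coroot dot (tnth al i)).

Definition tpar (i : 'I_r) : F := t (tnth al i).

Definition tprod (w : 'End(E)) : F := \prod_(i <- red_word dot al w) tpar i.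

Definition nabla (i : 'I_r) (f : {malg F[E]}) : {malg F[E]} :=
  gadiv (gamap (s_ i) f - f) (<< co_ i >> - << 0 >>).

Record hecke_relations (B : algType F) (T : 'I_r -> B) (X : E -> B) : Prop := {
  hecke_braid : forall i j m, i != j -> is_order (s_ i \o s_ j)%VF m ->
    altprod m (T i) (T j) = altprod m (T j) (T i);
  hecke_quad : forall j, (T j - (tpar j)%:A) * (T j + (tpar j)^-1%:A) = 0;
  hecke_X0 : X 0 = 1;
  hecke_XD : forall l m, Lam l -> Lam m -> X l * X m = X (l + m);
  hecke_cross : forall j l, Lam l ->
    T j * X l - X (s_ j l) * T j =
      (tpar j - (tpar j)^-1) *: gaeval X (nabla j << l >>) }.

(* H is the algebra presented by generators T_j, x^l (l in Lam) and the above
   relations. The unit structure of H carries no information: in a unitRingType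
   the units are exactly the two-sided invertible elements. *)
Definition is_affine_hecke (H : unitAlgType F) (T : 'I_r -> H) (X : E -> H) :
    Prop :=
  hecke_relations T X /\
  forall (B : algType F) (T' : 'I_r -> B) (X' : E -> B),
    hecke_relations T' X' ->
    exists2 h : {lrmorphism H -> B},
      (forall j, h (T j) = T' j) /\ (forall l, Lam l -> h (X l) = X' l) &
      forall g : {lrmorphism H -> B},
        (forall j, g (T j) = T' j) /\ (forall l, Lam l -> g (X l) = X' l) ->
        g =1 h.

Context (H : unitAlgType F) (T : 'I_r -> H) (X : E -> H).

Definition Tw (w : 'End(E)) : H := \prod_(i <- red_word dot al w) T i.

Record is_polynomial_rep (rho : H -> {malg F[E]} -> {malg F[E]}) : Prop := {
  pol_rep : is_representation (gaspan Lam) rho;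
  pol_T : forall j f, gaspan Lam f ->
    rho (T j) f = tpar j *: gamap (s_ j) f + (tpar j - (tpar j)^-1) *: nabla j f;
  pol_X : forall m f, Lam m -> gaspan Lam f -> rho (X m) f = gamul << m >> f }.

Definition chi (j : 'I_r) (a : R) : F := if a \is a Num.int then tpar j else 1.

Record is_quasi_polynomial_rep (rho : H -> {malg F[E]} -> {malg F[E]}) : Prop := {
  qp_rep : is_representation setT rho;
  qp_X : forall l y, Lam l -> rho (X l) << y >> = << l + y >>;
  qp_T : forall j y, let a := tnth al j y in
    rho (T j) << y >> = chi j a *: << s_ j y >>
      + (tpar j - (tpar j)^-1) *:
        gadiv (<< y - co_ j *~ Num.floor a >> - << y >>) (<< co_ j >> - << 0 >>) }.

(* The family of coefficients gamma_w(f) in F[Lam], w in W^c, of f in the basis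
   x^(w c) (w in W^c). *)
Definition gamma_qp (c : E) (f : {malg F[E]}) : 'End(E) -> {malg F[E]} :=
  xget (fun=> 0) [set g |
    (forall w, min_reps dot al Phi c w -> gaspan Lam (g w)) /\
    f = \sum_(w \in min_reps dot al Phi c) gamul (g w) << w c >>].

Definition eps_sym (rho : H -> {malg F[E]} -> {malg F[E]}) (eps : int) (c : E) :
    set {malg F[E]} :=
  [set f | gaspan (affine_orbit dot Phi Lam c) f /\
     forall i, rho (T i) f = (eps%:~R * tpar i ^ eps) *: f].

Definition eps_J_sym (rho : H -> {malg F[E]} -> {malg F[E]}) (eps : int) (c : E) :
    set {malg F[E]} :=
  [set p | gaspan Lam p /\
     forall j, s_ j c = c -> rho (T j) p = (eps%:~R * tpar j ^ eps) *: p].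

End Hecke.

(* Main.v *)
(* Write f = sum_(w in W^c) g_w x^(w c).  As 0 <= alpha(c) < 1 for all positive
   roots alpha, alpha_j(w c) lies in ]-1, 1[, so pi^qp(T_j) x^(w c) is t_j x^(w c),
   x^(s_j w c) or x^(s_j w c) + (t_j - t_j^-1) x^(w c), according to the sign of
   alpha_j(w c).  Hence f is eps-symmetric iff the g_w satisfy one equation for
   each j and w.  Let M be w_0 (eps = 1) or iota w_0 (eps = -1), and set V_j to be
   T_j^-1 (eps = 1) or - T_j (eps = -1).  With h_w = M g_w and w_0 alpha_j =
   - alpha_j', these equations become, for both signs of eps,
     h_w = V_j' h_(s_j w) if alpha_j(w c) > 0,
     V_j' h_w = t_j^-1 h_w if alpha_j(w c) = 0.
   Descending from w to the longest element w_0^c, the first equation gives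
   h_w = t(w_(0,c)) V_(w_0 w) h_(w_0^c), and the second one for w = w_0^c says
   that h_(w_0^c) is (eps, J_c)-symmetric.  Conversely, if p is
   (eps, J_c)-symmetric then h_w = t(w_0) V_(w_0 w) p solves the equations: when
   alpha_j(w c) = 0, s_j w = w s_i with i in J_c, so that
   V_j' V_(w_0 w) = V_(w_0 w) V_i.  The elements V_w are multiplicative along
   reduced words because T_w does not depend on the reduced word (Matsumoto). *)
From HB Require Import structures.
Require Import Defs.
From mathcomp Require Import all_boot all_order all_algebra finmap.
From mathcomp Require Import boolp classical_sets functions fsbigop reals.
From mathcomp Require Import sesquilinear.
From mathcomp Require Import cardinality ring zify.
From mathcomp.multinomials Require Import monalg.

Set Implicit Arguments.
Unset Strict Implicit.
Unset Printing Implicit Defensive.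

Import Order.TTheory GRing.Theory Num.Theory.
Local Open Scope classical_set_scope.
Local Open Scope ring_scope.

(** * Coroots and reflections *)

(** The shape of $V_j$ comes from the quadratic relation: for both signs
    $(V_j-t_j^{-1})(V_j+t_j)=0$, and the eigenvalue $\epsilon t_j^\epsilon$ of $T_j$ becomes the
    eigenvalue $t_j^{-1}$ of $V_j$. The map $M$ absorbs the remaining asymmetry, since $w_0$ sends
    $\alpha_j^\vee$ to $-\alpha_{j'}^\vee$ while $\iota w_0$ sends it to $\alpha_{j'}^\vee$. The
    scalar $t(w_{0,c})$ arises because $w_0w_0^c=w_{0,c}$ and $V_{w_{0,c}}$ acts on an
    $(\epsilon,J_c)$-symmetric $p$ by $t(w_{0,c})^{-1}$. The factor $t(w_0)$ is a normalisation:
    with it the bijection is the identity for $c=0$, $\epsilon=1$. Quotients, reduced words and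
    coefficients are all picked by [xget], so each rests on a uniqueness result: absence of zero
    divisors, Matsumoto's theorem, freeness over $F[\Lambda]$. Freeness and the strict bound
    $\alpha(c)<1$ are both extracted from the condition on the affine stabilizer of $c$. *)

Section Reflections.
Context (R : realType) (E : vectType R) (dot : {dot E for @idfun R}).
Implicit Types (a b : 'Hom(E, R^o)) (u v w : 'End(E)) (x y z : E).

Lemma dotC x y : dot x y = dot y x.
Proof. by have := hermC dot x y; rewrite /= expr0 mul1r. Qed.

Lemma dotxx_eq0 x : (dot x x == 0) = (x == 0).
Proof.
apply/eqP/eqP => [|->]; last by rewrite linear0l.
by apply: contra_eq => /(neq0_dnorm_gt0 (s := dot)) /lt0r_neq0.
Qed.

Lemma dot_inj x y : (forall z, dot z x = dot z y) -> x = y.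
Proof.
move=> h; apply/eqP; rewrite -subr_eq0 -dotxx_eq0 linearBr /=.
by rewrite h subrr.
Qed.

Let musical x : 'Hom(E, R^o) := linfun (fun y => dot y x : R^o).

Let musicalE x y : musical x y = dot y x.
Proof.
have lin : linear (fun y => dot y x : R^o).
  by move=> k u v; rewrite linearPl.
pose f : {linear E -> R^o} := HB.pack (fun y => dot y x : R^o)
  (GRing.isLinear.Build R E R^o *:%R (fun y => dot y x : R^o) lin).
by rewrite /musical -/(linfun f) (lfunE f).
Qed.

(** The map from $E$ to its dual given by the inner product is injective, hence onto by dimension,
    so the [xget] in [riesz] has something to find. *)
Lemma rieszP a y : dot y (riesz dot a) = a y.
Proof.
have lin : linear musical.
  move=> k x z; apply/lfunP => t. rewrite add_lfunE scale_lfunE.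
  by rewrite !musicalE linearPr.
pose f : {linear E -> 'Hom(E, R^o)} := HB.pack musical
  (GRing.isLinear.Build R E 'Hom(E, R^o) *:%R musical lin).
have ker0 : lker (linfun f) == 0%VS.
  apply/lker0P => x z; rewrite !lfunE /= => h; apply: dot_inj => t.
  by rewrite -!musicalE h.
have : a \in limg (linfun f).
  suff -> : limg (linfun f) = fullv by rewrite memvf.
  apply/eqP; rewrite eqEdim subvf limg_dim_eq; last first.
    by apply/eqP; rewrite (eqP ker0) capv0.
  by rewrite !dimvf /dim /= muln1.
case/memv_imgP => x _ ax.
rewrite /riesz; case: xgetP => [z -> //|/(_ x)[] t].
by rewrite ax lfunE /= musicalE.
Qed.

End Reflections.

Section Coroots.
Context (R : realType) (E : vectType R) (dot : {dot E for @idfun R}).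
Implicit Types (a b : 'Hom(E, R^o)) (u v w : 'End(E)) (x y z : E).

Local Notation riesz := (riesz dot).
Local Notation ddot := (ddot dot).
Local Notation coroot := (coroot dot).
Local Notation refl := (refl dot).

Lemma hom_scale a (k : R) x : a (k *: x) = k * a x.
Proof. by rewrite linearZ. Qed.

Lemma ddotE a b : ddot a b = b (riesz a).
Proof. by rewrite /ddot rieszP. Qed.

Lemma ddotC a b : ddot a b = ddot b a.
Proof. exact: dotC. Qed.

Lemma ddot_gt0 a : a != 0 -> 0 < ddot a a.
Proof.
move=> a0; apply: neq0_dnorm_gt0; apply: contraNneq a0 => ra0.
by apply/eqP/lfunP => y; rewrite zero_lfunE -(rieszP dot) ra0 linear0r.
Qed.

Lemma corootE a : coroot a = (2 / ddot a a) *: riesz a.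
Proof.
have h y : dot y ((2 / ddot a a) *: riesz a) = 2 * a y / ddot a a.
  by rewrite linearZr /= rieszP mulrAC.
rewrite /coroot; case: xgetP => [x _ /= hx|/(_ _ h)//].
by apply: (@dot_inj _ _ dot) => z; rewrite hx h.
Qed.

Lemma pairingE a b : b (coroot a) = 2 * ddot a b / ddot a a.
Proof. by rewrite corootE hom_scale (ddotE a b) mulrAC. Qed.

Lemma pairing_self a : a != 0 -> a (coroot a) = 2.
Proof. by move=> /ddot_gt0 a0; rewrite pairingE mulfK // gt_eqF. Qed.

Lemma coroot_neq0 a : a != 0 -> coroot a != 0.
Proof.
move=> /pairing_self h; apply/eqP => c0; move: h; rewrite c0 linear0.
by move=> /esym /eqP; rewrite pnatr_eq0.
Qed.

Lemma pairing_gt0C a b : a != 0 -> b != 0 ->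
  (0 < b (coroot a)) = (0 < a (coroot b)).
Proof.
move=> /ddot_gt0 a0 /ddot_gt0 b0; rewrite !pairingE (ddotC b a).
by rewrite -!mulrA !(@pmulr_rgt0 _ 2) // !(@pmulr_lgt0 _ _^-1) ?invr_gt0.
Qed.

Lemma reflE a y : refl a y = y - a y *: coroot a.
Proof.
have lin : linear (fun y => y - a y *: coroot a).
  move=> k u v; rewrite linearP /= scalerDl -scalerA scalerBr opprD.
  by rewrite addrACA.
pose f : {linear E -> E} := HB.pack (fun y => y - a y *: coroot a)
  (GRing.isLinear.Build R E E *:%R _ lin).
by rewrite /refl -/(linfun f) (lfunE f).
Qed.

Lemma refl_pairing a b y : b (refl a y) = b y - a y * b (coroot a).
Proof. by rewrite reflE linearB /= hom_scale. Qed.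

Lemma comp_refl a b : (b \o refl a)%VF = b - b (coroot a) *: a.
Proof.
apply/lfunP => y; rewrite comp_lfunE refl_pairing add_lfunE opp_lfunE.
by rewrite scale_lfunE mulrC.
Qed.

Lemma comp_refl_self a : a != 0 -> (a \o refl a)%VF = - a.
Proof.
move=> a0; rewrite comp_refl pairing_self // scaler_nat mulr2n opprD.
by rewrite addrA subrr add0r.
Qed.

Lemma refl_coroot a : a != 0 -> refl a (coroot a) = - coroot a.
Proof.
move=> a0; rewrite reflE pairing_self // scaler_nat mulr2n opprD.
by rewrite addrA subrr add0r.
Qed.

Lemma reflK a : a != 0 -> involutive (refl a).
Proof.
move=> a0 y; rewrite [LHS]reflE -comp_lfunE comp_refl_self // reflE.
by rewrite opp_lfunE scaleNr opprK subrK.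
Qed.

Lemma refl_compK a : a != 0 -> (refl a \o refl a)%VF = \1%VF.
Proof.
by move=> a0; apply/lfunP => y; rewrite comp_lfunE reflK // id_lfunE.
Qed.

Lemma refl_fix a y : a != 0 -> refl a y = y <-> a y = 0.
Proof.
move=> a0; rewrite reflE; split=> [/eqP|->]; last by rewrite scale0r subr0.
rewrite -subr_eq0 addrAC subrr add0r oppr_eq0 scaler_eq0.
by rewrite (negPf (coroot_neq0 a0)) orbF => /eqP.
Qed.

Lemma dot_coroot a x : dot x (coroot a) = 2 / ddot a a * a x.
Proof. by rewrite corootE linearZr /= rieszP. Qed.

Lemma dot_refl a x y : dot x (refl a y) = dot x y - a y * (2 / ddot a a * a x).
Proof. by rewrite reflE linearBr linearZr /= dot_coroot. Qed.

Lemma refl_isometry a y z : a != 0 -> dot (refl a y) (refl a z) = dot y z.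
Proof.
move=> a0; rewrite dot_refl [dot _ z]dotC dot_refl [dot z y]dotC.
rewrite -comp_lfunE comp_refl_self // opp_lfunE !mulrN opprK.
ring.
Qed.

Lemma corootN a : coroot (- a) = - coroot a.
Proof.
have rN : riesz (- a) = - riesz a.
  by apply: (@dot_inj _ _ dot) => z; rewrite linearNr /= !rieszP opp_lfunE.
rewrite !corootE rN scalerN; congr (- (2 / _ *: _)).
by rewrite !ddotE opp_lfunE rN linearN opprK.
Qed.

Lemma reflN a : refl (- a) = refl a.
Proof.
by apply/lfunP => y; rewrite !reflE corootN opp_lfunE scaleNr scalerN opprK.
Qed.

(** The functional [a \o w] is $w^{-1}a$; an isometry carries Riesz vectors along, hence coroots
    too. *)
Lemma coroot_comp a w w' : (forall y z, dot (w y) (w z) = dot y z) ->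
  cancel w' w -> cancel w w' -> coroot (a \o w)%VF = w' (coroot a).
Proof.
move=> iso K K'.
have iso' y z : dot (w' y) (w' z) = dot y z by rewrite -iso !K.
rewrite !corootE linearZ /=.
have rw : riesz (a \o w)%VF = w' (riesz a).
  apply: (@dot_inj _ _ dot) => z.
  by rewrite -[in RHS](K' z) iso' !rieszP comp_lfunE.
congr (2 / _ *: _); rewrite ?rw // !ddotE rw comp_lfunE K.
by [].
Qed.

Lemma refl_comp a w w' : (forall y z, dot (w y) (w z) = dot y z) ->
  cancel w' w -> cancel w w' -> refl (a \o w)%VF = (w' \o refl a \o w)%VF.
Proof.
move=> iso K K'; apply/lfunP => y; rewrite !comp_lfunE !reflE.
by rewrite (coroot_comp _ iso K K') comp_lfunE [in RHS]linearB [in RHS]linearZ /= K'.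
Qed.

End Coroots.

(** * The group algebra *)

Section GroupAlgebraTheory.
Context (F : fieldType) (E : zmodType).
Implicit Types (f g h : {malg F[E]}) (x y z : E) (S : set E).
Local Open Scope fset_scope.
Local Open Scope ring_scope.

(** Summing over any finite set that contains the support puts $f$, $g$ and $kf+g$ on one index set,
    as linearity requires. *)
Lemma gaevalEw (B : lmodType F) (X : E -> B) (d : {fset E}) f :
  (msupp f `<=` d)%fset -> gaeval X f = \sum_(y <- d) f@_y *: X y.
Proof.
move=> fd; rewrite /gaeval [RHS](big_fsetID _ (mem (msupp f))) /=.
rewrite [X in _ = _ + X]big1_fset ?addr0 => [|y]; last first.
  by rewrite !inE => /andP[_ yf] _; rewrite mcoeff_outdom // scale0r.
apply: eq_fbigl => y; rewrite !inE /=.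
by case yf: (y \in msupp f); rewrite ?andbF // (fsubsetP fd).
Qed.

Lemma gaeval_is_linear (B : lmodType F) (X : E -> B) : linear (gaeval X).
Proof.
move=> k f g; pose d := (msupp (k *: f + g) `|` (msupp f `|` msupp g))%fset.
have s1 : (msupp (k *: f + g) `<=` d)%fset by exact: fsubsetUl.
have s2 : (msupp f `<=` d)%fset.
  by apply: fsubset_trans (fsubsetUr _ _); exact: fsubsetUl.
have s3 : (msupp g `<=` d)%fset.
  by apply: fsubset_trans (fsubsetUr _ _); exact: fsubsetUr.
rewrite (gaevalEw X s1) (gaevalEw X s2) (gaevalEw X s3).
rewrite scaler_sumr -big_split; apply: eq_bigr => y _ /=.
by rewrite mcoeffD mcoeffZ scalerDl scalerA.
Qed.

HB.instance Definition _ (B : lmodType F) (X : E -> B) :=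
  GRing.isLinear.Build F {malg F[E]} B *:%R (gaeval X) (gaeval_is_linear X).

Lemma gaU k y : << k *g y >> = k *: << y >> :> {malg F[E]}.
Proof. by apply/malgP => z; rewrite mcoeffZ !mcoeffU mulr_natr. Qed.

Lemma gaevalU (B : lmodType F) (X : E -> B) y : gaeval X << y >> = X y.
Proof.
rewrite (@gaevalEw _ X [fset y]%fset) ?msuppU_le //.
by rewrite big_seq_fset1 mcoeffUU scale1r.
Qed.

Lemma ga_expand f : f = \sum_(y <- msupp f) f@_y *: << y >>.
Proof. by rewrite {1}[f]monalgE; apply: eq_bigr => y _; rewrite gaU. Qed.

Lemma gaspan_ind S (P : {malg F[E]} -> Prop) : P 0 ->
  (forall k f g, gaspan S f -> gaspan S g -> P f -> P g -> P (k *: f + g)) ->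
  (forall y, S y -> P << y >>) -> forall f, gaspan S f -> P f.
Proof.
move=> P0 PD PU f fS; rewrite (ga_expand f).
(* Membership in the span is carried along because [PD] asks for it at every partial sum. *)
suff : forall s : seq E, {in s, forall y, S y} ->
    P (\sum_(y <- s) f@_y *: << y >>) /\ gaspan S (\sum_(y <- s) f@_y *: << y >>).
  by move=> /(_ (msupp f) fS)[].
elim=> [|y s IH] sS; first by rewrite big_nil; split=> // z; rewrite msupp0 inE.
have [Ps Ss] : P (\sum_(z <- s) f@_z *: << z >>) /\
    gaspan S (\sum_(z <- s) f@_z *: << z >>).
  by apply: IH => z zs; apply: sS; rewrite inE zs orbT.
have yS : S y by apply: sS; rewrite mem_head.
have spy : gaspan S (<< y >> : {malg F[E]}).
  by move=> z /(fsubsetP msuppU_le); rewrite inE => /eqP->.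
rewrite big_cons; split; first by apply: PD => //; exact: PU.
move=> z /(fsubsetP (msuppD_le _ _)); rewrite inE => /orP[|/Ss //].
by move=> /(fsubsetP (msuppZ_le _ _)) /spy.
Qed.

Lemma ga_ind (P : {malg F[E]} -> Prop) : P 0 ->
  (forall k f g, P f -> P g -> P (k *: f + g)) ->
  (forall y, P << y >>) -> forall f, P f.
Proof.
by move=> P0 PD PU f; apply: (@gaspan_ind setT P) => // k *; exact: PD.
Qed.

Lemma gamapE (h : E -> E) f : gamap h f = gaeval (fun y => << h y >>) f.
Proof. by apply: eq_bigr => y _; rewrite gaU. Qed.

Lemma gamap_is_linear (h : E -> E) : linear (@gamap F E h).
Proof. by move=> k f g; rewrite !gamapE linearP. Qed.

HB.instance Definition _ (h : E -> E) := GRing.isLinear.Build F {malg F[E]}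
  {malg F[E]} *:%R (@gamap F E h) (gamap_is_linear h).

Lemma gamapU (h : E -> E) y : gamap h << y >> = << h y >> :> {malg F[E]}.
Proof. by rewrite gamapE gaevalU. Qed.

Lemma gamap_comp (h k : E -> E) f : gamap h (gamap k f) = gamap (h \o k) f.
Proof.
elim/ga_ind: f => [|a f g IHf IHg|y]; first by rewrite !raddf0.
  by rewrite !linearP /= IHf IHg.
by rewrite !gamapU.
Qed.

Lemma eq_gamap (h k : E -> E) f : h =1 k -> gamap h f = gamap k f.
Proof. by move=> hk; rewrite !gamapE; apply: eq_bigr => y _; rewrite hk. Qed.

Lemma gamap_id f : gamap id f = f.
Proof. by rewrite gamapE [RHS]ga_expand. Qed.

Lemma gamulE f g : gamul f g = gaeval (fun y => gaeval (fun z => << y + z >>) g) f.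
Proof.
rewrite /gamul /gaeval; apply: eq_bigr => y _.
by rewrite scaler_sumr; apply: eq_bigr => z _; rewrite gaU scalerA.
Qed.

Lemma gamul_is_bilinear : bilinear_for
  (GRing.Scale.Law.clone _ _ *:%R _) (GRing.Scale.Law.clone _ _ *:%R _)
  (@gamul F E).
Proof.
split=> [g|g] k f f' /=; first by rewrite !gamulE linearP.
rewrite !gamulE /gaeval scaler_sumr -big_split; apply: eq_bigr => y _ /=.
by rewrite -!/(gaeval _ _) linearP scalerDr !scalerA mulrC.
Qed.

HB.instance Definition _ := bilinear_isBilinear.Build F {malg F[E]} {malg F[E]}
  {malg F[E]} _ _ (@gamul F E) gamul_is_bilinear.

Lemma gamulUU y z : gamul << y >> << z >> = << y + z >> :> {malg F[E]}.
Proof. by rewrite gamulE !gaevalU. Qed.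

Lemma gamulA f g h : gamul f (gamul g h) = gamul (gamul f g) h.
Proof.
elim/ga_ind: f => [|a f f' IHf IHg|x]; first by rewrite !linear0l.
  by rewrite !linearPl /= IHf IHg.
elim/ga_ind: g => [|a f f' IHf IHg|y].
- by rewrite [gamul 0 h]linear0l !linear0r linear0l.
- by rewrite linearPl !linearPr /= linearPl /= IHf IHg.
elim/ga_ind: h => [|a f f' IHf IHg|z]; first by rewrite !linear0r.
  by rewrite !linearPr /= IHf IHg.
by rewrite !gamulUU addrA.
Qed.

Lemma gamul1r f : gamul f << 0 >> = f.
Proof.
elim/ga_ind: f => [|a f f' IHf IHg|x]; first by rewrite linear0l.
  by rewrite linearPl /= IHf IHg.
by rewrite gamulUU addr0.
Qed.

Lemma gamap_mul (k : {additive E -> E}) f g :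
  gamap k (gamul f g) = gamul (gamap k f) (gamap k g).
Proof.
elim/ga_ind: f => [|a f f' IHf IHg|y]; first by rewrite !(linear0l, raddf0).
  by rewrite linearPl !linearP /= linearPl IHf IHg.
elim/ga_ind: g => [|a f f' IHf IHg|z]; first by rewrite !(linear0r, raddf0).
  by rewrite linearPr !linearP /= linearPr /= IHf IHg.
by rewrite gamulUU !gamapU gamulUU raddfD.
Qed.

Lemma mcoeff_gamulU f y z : (gamul f << z >>)@_y = f@_(y - z).
Proof.
elim/ga_ind: f => [|a f f' IHf IHg|x]; first by rewrite linear0l !mcoeff0.
  by rewrite linearPl !mcoeffD !mcoeffZ IHf IHg.
by rewrite gamulUU !mcoeffU [x == _]eq_sym subr_eq eq_sym.
Qed.

Lemma gamap_lin (h : E -> E) k f g :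
  gamap h (k *: f + g) = k *: gamap h f + gamap h g.
Proof. exact: linearP. Qed.

Lemma gamul_linl k f g h : gamul (k *: f + g) h = k *: gamul f h + gamul g h.
Proof. exact: linearPl. Qed.

Lemma gamul_linr k f g h : gamul h (k *: f + g) = k *: gamul h f + gamul h g.
Proof. exact: linearPr. Qed.

Lemma gamul0l f : gamul 0 f = 0. Proof. exact: linear0l. Qed.

Lemma gamul0r f : gamul f 0 = 0. Proof. exact: linear0r. Qed.

Lemma gamulDl f g h : gamul (f + g) h = gamul f h + gamul g h.
Proof. exact: linearDl. Qed.

Lemma gamulDr f g h : gamul f (g + h) = gamul f g + gamul f h.
Proof. exact: linearDr. Qed.

Lemma gamulZl k f g : gamul (k *: f) g = k *: gamul f g.
Proof. exact: linearZl_LR. Qed.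

Lemma gamulZr k f g : gamul f (k *: g) = k *: gamul f g.
Proof. exact: linearZr_LR. Qed.

Lemma gamap0 (h : E -> E) : gamap h 0 = 0 :> {malg F[E]}.
Proof. exact: linear0. Qed.

Lemma gaspanP S f : gaspan S f <-> forall y, f@_y != 0 -> S y.
Proof. by split=> fS y; have := fS y; rewrite mcoeff_neq0. Qed.

Lemma gaspan0 S : gaspan S (0 : {malg F[E]}).
Proof. by move=> y; rewrite msupp0 inE. Qed.

Lemma gaspanP_lin S k f g : gaspan S f -> gaspan S g -> gaspan S (k *: f + g).
Proof.
move=> fS gS y /(fsubsetP (msuppD_le _ _)); rewrite inE => /orP[|/gS //].
by move=> /(fsubsetP (msuppZ_le _ _)) /fS.
Qed.

Lemma gaspanZ S k f : gaspan S f -> gaspan S (k *: f).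
Proof.
by move=> fS; rewrite -[_ *: _]addr0; apply: gaspanP_lin fS _; exact: gaspan0.
Qed.

Lemma gaspanD S f g : gaspan S f -> gaspan S g -> gaspan S (f + g).
Proof. by move=> fS; rewrite -[f]scale1r; exact: gaspanP_lin. Qed.

Lemma gaspanN S f : gaspan S f -> gaspan S (- f).
Proof. by rewrite -scaleN1r; exact: gaspanZ. Qed.

Lemma gaspanB S f g : gaspan S f -> gaspan S g -> gaspan S (f - g).
Proof. by move=> fS gS; apply: gaspanD => //; exact: gaspanN. Qed.

Lemma gaspanU S y : S y -> gaspan S (<< y >> : {malg F[E]}).
Proof. by move=> yS z /(fsubsetP msuppU_le); rewrite inE => /eqP->. Qed.

Lemma gaspan_sum S (I : eqType) (s : seq I) (G : I -> {malg F[E]}) :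
  {in s, forall i, gaspan S (G i)} -> gaspan S (\sum_(i <- s) G i).
Proof.
move=> GS; rewrite big_seq; elim/big_ind: _ => //; first exact: gaspan0.
by move=> f g; exact: gaspanD.
Qed.

Lemma gaspan_map S S' (h : E -> E) f :
  (forall y, S y -> S' (h y)) -> gaspan S f -> gaspan S' (gamap h f).
Proof.
move=> hS; move: f.
apply: (@gaspan_ind S (fun f => gaspan S' (gamap h f))) => [|k f g _ _ IHf IHg|y yS].
- by rewrite raddf0; exact: gaspan0.
- by rewrite linearP /=; apply: gaspanP_lin.
- by rewrite gamapU; apply: gaspanU; exact: hS.
Qed.

Lemma gaspan_mulU S S' f z :
  (forall y, S y -> S' (y + z)) -> gaspan S f -> gaspan S' (gamul f << z >>).
Proof.
move=> zS; move: f.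
apply: (@gaspan_ind S (fun f => gaspan S' (gamul f << z >>)))
  => [|k f g _ _ IHf IHg|y yS].
- by rewrite linear0l; exact: gaspan0.
- by rewrite linearPl; exact: gaspanP_lin.
- by rewrite gamulUU; apply: gaspanU; exact: zS.
Qed.

(* Otherwise the support of g would contain a whole ray y + n x. *)
Lemma ga_nonzero_divisor x (u : F) g : (forall n, x *+ n.+1 != 0) ->
  gamul g (<< x >> - u *: << 0 >>) = 0 -> g = 0.
Proof.
move=> tf; rewrite linearBr linearZr /= gamul1r => /eqP; rewrite subr_eq0 => /eqP gE.
have step y : g@_y != 0 -> g@_(y + x) != 0.
  apply: contra_neq => gx; rewrite -[y](addrK x) -mcoeff_gamulU gE mcoeffZ gx.
  by rewrite mulr0.
apply/malgP => y; rewrite mcoeff0; apply/eqP/contraT => gy.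
have gyn n : g@_(y + x *+ n) != 0.
  elim: n => [|n IH]; first by rewrite mulr0n addr0.
  by rewrite mulrSr addrA; exact: step.
pose s := [seq y + x *+ n | n <- iota 0 (size (msupp g)).+1].
have us : uniq s.
  rewrite map_inj_uniq ?iota_uniq // => m n /addrI mn.
  wlog le : m n mn / (m <= n)%N.
    by move=> h; case/orP: (leq_total m n) => ?; [|symmetry]; apply: h.
  have := subrr (x *+ n); rewrite -{2}mn -mulrnBr //.
  case mnE: (n - m)%N => [|k]; last by move=> /eqP; rewrite (negPf (tf k)).
  by move=> _; apply/eqP; rewrite eqn_leq le -subn_eq0 mnE.
have sg : {subset s <= msupp g}.
  by move=> _ /mapP[n _ ->]; rewrite -mcoeff_neq0.
by have := uniq_leq_size us sg; rewrite size_map size_iota ltnn.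
Qed.

(** Two quotients differ by an element that [<< x >> - << 0 >>] annihilates, so [xget] can only
    return [q]. *)
Lemma gadivP x f q : (forall n, x *+ n.+1 != 0) ->
  gamul q (<< x >> - << 0 >>) = f -> gadiv f (<< x >> - << 0 >>) = q.
Proof.
move=> tf qf; rewrite /gadiv; case: xgetP => [q' _ /= q'f|/(_ q)//].
apply/eqP; rewrite -subr_eq0; apply/eqP.
by apply: (@ga_nonzero_divisor x 1) => //; rewrite scale1r linearBl /= qf q'f subrr.
Qed.

End GroupAlgebraTheory.

(** * Divided differences *)

Section DividedDifference.
Context (F : fieldType) (E : zmodType) (S : set E) (s : {additive E -> E}) (x : E).
Hypotheses (S0 : S 0) (SB : forall y z, S y -> S z -> S (y - z)) (Sx : S x).
Hypotheses (sK : involutive s) (sx : s x = - x).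
Hypothesis sS : forall y, S y -> exists m : int, s y = y - x *~ m.
Hypothesis x_tf : forall n, x *+ n.+1 != 0.
Implicit Types (f g : {malg F[E]}) (y z : E).

Local Notation dn := (<< x >> - << 0 >> : {malg F[E]}).

(** This is $\nabla_j$ for an abstract involution $s$ that negates $x$ and moves points of $S$ by
    integer multiples of $x$. It is applied to $s_j$ and to $s_{j'}$, which $M$ interchanges. *)
Definition divdiff f : {malg F[E]} := gadiv (gamap s f - f) dn.

Let Sxn n : S (x *+ n).
Proof.
elim: n => [|n IH]; first exact: S0.
by rewrite mulrSr -[x in _ + x]opprK; apply: SB => //; rewrite -sub0r; exact: SB.
Qed.

Lemma sub_stable y : S y -> S (s y).
Proof.
move=> yS; have [m ->] := sS yS; apply: SB => //; case: m => n; first exact: Sxn.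
by rewrite NegzE mulrNz -sub0r; apply: SB => //; exact: Sxn.
Qed.

Lemma gaspan_s f : gaspan S f -> gaspan S (gamap s f).
Proof. exact: gaspan_map sub_stable. Qed.

(** The quotient is minus the geometric sum of [<< y - x *+ k >>] for $1\le k\le n$. *)
Let divdiff_power n y : S y ->
  exists2 q : {malg F[E]}, gaspan S q & gamul q dn = << y - x *+ n >> - << y >>.
Proof.
move=> yS; elim: n => [|n [q qS qE]].
  by exists 0; [exact: gaspan0|rewrite linear0l mulr0n subr0 subrr].
exists (q - << y - x *+ n.+1 >>).
  by apply: gaspanB => //; apply: gaspanU; apply: SB => //; exact: Sxn.
have yx : y - x *+ n.+1 + x = y - x *+ n by rewrite mulrSr opprD addrA subrK.
rewrite linearBl /= qE [X in _ - X]linearBr /= !gamulUU addr0 yx.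
by apply/malgP => z; rewrite !mcoeffB; ring.
Qed.

Let divdiff_exists f : gaspan S f ->
  exists2 q, gaspan S q & gamul q dn = gamap s f - f.
Proof.
move: f; apply: gaspan_ind => [|k f g _ _ [p pS pE] [q qS qE]|y yS].
- by exists 0; [exact: gaspan0|rewrite linear0l raddf0 subrr].
- exists (k *: p + q); first exact: gaspanP_lin.
  by rewrite linearPl /= pE qE linearP /= scalerBr opprD addrACA.
have [m sy] := sS yS; rewrite gamapU sy; case: m sy => n sy.
  exact: divdiff_power.
(* For a negative multiple $y=sy-(n+1)x$, so the geometric quotient at $sy$ serves with the opposite
   sign. *)
have [|q qS qE] := @divdiff_power n.+1 (s y); first exact: sub_stable.
exists (- q); first exact: gaspanN.
by rewrite linearNl /= qE opprB sy NegzE mulrNz opprK addrK.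
Qed.

Lemma divdiffP f : gaspan S f ->
  gaspan S (divdiff f) /\ gamul (divdiff f) dn = gamap s f - f.
Proof. by move=> /divdiff_exists[q qS qE]; rewrite /divdiff (gadivP x_tf qE). Qed.

Lemma divdiff_span f : gaspan S f -> gaspan S (divdiff f).
Proof. by move=> /divdiffP[]. Qed.

Lemma divdiffE f : gaspan S f -> gamul (divdiff f) dn = gamap s f - f.
Proof. by move=> /divdiffP[]. Qed.

Lemma divdiff_unique f q : gamul q dn = gamap s f - f -> divdiff f = q.
Proof. exact: gadivP. Qed.

Lemma divdiffP_lin k f g : gaspan S f -> gaspan S g ->
  divdiff (k *: f + g) = k *: divdiff f + divdiff g.
Proof.
move=> fS gS; apply: divdiff_unique.
by rewrite linearPl /= !divdiffE // linearP /= scalerBr opprD addrACA.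
Qed.

Lemma gamap_sK : involutive (@gamap F E s).
Proof. by move=> f; rewrite gamap_comp (eq_gamap _ sK) gamap_id. Qed.

Let dn_s : gamap s dn = - gamul dn << - x >>.
Proof.
rewrite linearB /= !gamapU sx raddf0 linearBl /= !gamulUU subrr add0r opprB.
by [].
Qed.

(** Applying $s$ to the defining equation shows that $s$ acts on $\nabla f$ as multiplication by
    [<< x >>]; splitting off the denominator leaves $\nabla f+(sf-f)$. *)
Lemma gamap_s_divdiff f : gaspan S f ->
  gamap s (divdiff f) = divdiff f - f + gamap s f.
Proof.
move=> fS; have dE := divdiffE fS.
have dnE : dn = - gamul (gamap s dn) << x >>.
  by rewrite dn_s linearNl /= opprK -gamulA gamulUU addNr gamul1r.
have e1 : gamul (gamap s (divdiff f)) dn = gamul (gamap s f - f) << x >>.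
  rewrite [X in gamul _ X]dnE linearNr /= gamulA -gamap_mul dE linearB /=.
  by rewrite gamap_sK -linearNl /= opprB.
have e2 g : gamul g dn = gamul g << x >> - g by rewrite linearBr /= gamul1r.
apply/eqP; rewrite -subr_eq0; apply/eqP.
apply: (@ga_nonzero_divisor _ _ x 1) => //; rewrite scale1r linearBl /= e1.
rewrite !linearDl /= linearNl /= dE [gamul (- f) dn]linearNl /= !e2.
by apply/malgP => y; rewrite !(mcoeffB, mcoeffD, mcoeffN) mcoeff0; ring.
Qed.

Lemma divdiff_s f : gaspan S f -> divdiff (gamap s f) = - divdiff f.
Proof.
move=> fS; apply: divdiff_unique.
by rewrite linearNl /= divdiffE // gamap_sK opprB.
Qed.

(** For $q=sf-f$ the eigenvalue equation, multiplied by the denominator, says that $q$ is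
    annihilated by [<< x >> - t^-1 ^+ 2 *: << 0 >>]. This is why [ga_nonzero_divisor] admits a
    scalar. *)
Lemma divdiff_eigen (t : F) f : t != 0 -> gaspan S f ->
  t *: gamap s f + (t - t^-1) *: divdiff f = t *: f <-> gamap s f = f.
Proof.
move=> t0 fS; split=> [h|sf]; last first.
  by rewrite sf (@divdiff_unique _ 0) ?scaler0 ?addr0 // linear0l sf subrr.
apply/eqP; rewrite -subr_eq0; apply/eqP.
apply: (@ga_nonzero_divisor _ _ x (t^-1 ^+ 2)) => //.
have {h} e1 : gamap s f - f = (- (t^-1 * (t - t^-1))) *: divdiff f.
  apply: (can_inj (scalerK t0)); rewrite scalerBr -h scalerA.
  by apply/malgP => y; rewrite !(mcoeffB, mcoeffD, mcoeffN, mcoeffZ); field.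
have e2 : gamul (gamap s f - f) dn = (- (t^-1 * (t - t^-1))) *: (gamap s f - f).
  by rewrite {1}e1 linearZl_LR /= divdiffE.
move: e2; set q := gamap s f - f => e2.
have -> : << x >> - t^-1 ^+ 2 *: << 0 >> = dn + (1 - t^-1 ^+ 2) *: << 0 >>.
  by rewrite scalerBl scale1r addrA subrK.
rewrite linearDr linearZr /= e2 gamul1r -scalerDl.
have -> : - (t^-1 * (t - t^-1)) + (1 - t^-1 ^+ 2) = 0 by field.
by rewrite scale0r.
Qed.

End DividedDifference.

(** * Transport of divided differences and coefficient equations through an involution *)

Section Intertwining.
Context (F : fieldType) (E : zmodType) (S : set E).
Context (s s' A : {additive E -> E}) (x x' : E).
Hypotheses (S0 : S 0) (SB : forall y z, S y -> S z -> S (y - z)).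
Hypotheses (Sx : S x) (sK : involutive s) (sx : s x = - x).
Hypothesis sS : forall y, S y -> exists m : int, s y = y - x *~ m.
Hypothesis x_tf : forall n, x *+ n.+1 != 0.
Hypotheses (Sx' : S x') (s'K : involutive s') (s'x : s' x' = - x').
Hypothesis s'S : forall y, S y -> exists m : int, s' y = y - x' *~ m.
Hypothesis x'_tf : forall n, x' *+ n.+1 != 0.
Hypotheses (AS : forall y, S y -> S (A y)) (AK : involutive A).
Hypothesis As : forall y, A (s y) = s' (A y).
Implicit Types (f g : {malg F[E]}) (y z : E).

Local Notation N := (divdiff s x).
Local Notation N' := (divdiff s' x').

Let Asf f : gamap A (gamap s f) = gamap s' (gamap A f).
Proof. by rewrite !gamap_comp; apply: eq_gamap. Qed.

Lemma divdiff_intertwine f : A x = x' -> gaspan S f ->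
  gamap A (N f) = N' (gamap A f).
Proof.
move=> Ax fS; apply/esym/divdiff_unique => //; rewrite -Asf -linearB /=.
rewrite -(divdiffE S0 SB Sx sS x_tf fS) gamap_mul; congr (gamul _ _).
by rewrite linearB /= !gamapU Ax raddf0.
Qed.

(** Since $s'A$ maps $x$ to $x'$, it intertwines $\nabla$ and $\nabla'$; applying $s'$ once more
    returns to $A$ and produces the correction terms. *)
Lemma divdiff_intertwineN f : A x = - x' -> gaspan S f ->
  gamap A (N f) = gamap A f - gamap s' (gamap A f) - N' (gamap A f).
Proof.
move=> Ax fS; have Af := gaspan_map AS fS.
have : gamap s' (gamap A (N f)) = - N' (gamap A f).
  rewrite -(divdiff_s S0 SB Sx' s'K s'S x'_tf Af); apply/esym/divdiff_unique => //.
  rewrite -!Asf -!linearB /= -(divdiffE S0 SB Sx sS x_tf fS) !gamap_mul.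
  by congr (gamul _ _); rewrite !linearB /= !gamapU !raddf0 sx raddfN Ax opprK.
move=> /(congr1 (gamap s')); rewrite gamap_sK // => ->.
rewrite linearN /= (gamap_s_divdiff S0 SB Sx' s'K s'x s'S x'_tf) //.
by apply/malgP => y; rewrite !(mcoeffB, mcoeffD, mcoeffN); ring.
Qed.

Variable t : F.
Hypothesis t0 : t != 0.

Let τ := t - t^-1.
Let T f := t *: gamap s f + τ *: N f.
Let T' f := t *: gamap s' f + τ *: N' f.

Let gaAK : involutive (@gamap F E A).
Proof. exact: gamap_sK. Qed.

(** The neighbouring coefficient [g'] is isolated, so that only the right-hand side has to be
    recognised as an action of $T'$ or its inverse. *)
Let transfer (g' p q : {malg F[E]}) :
  gamap s g' + p = q <-> gamap A g' = gamap s' (gamap A q - gamap A p).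
Proof.
rewrite -linearB /= -Asf; split=> [<-|].
  by rewrite addrK gamap_sK.
by move=> /(can_inj gaAK) ->; rewrite gamap_sK // subrK.
Qed.

Let N'span f : gaspan S f -> gamap s' (N' f) = N' f - f + gamap s' f.
Proof. exact: (gamap_s_divdiff S0 SB Sx' s'K s'x s'S x'_tf). Qed.

Let AZ k f : gamap A (k *: f) = k *: gamap A f.
Proof. exact: linearZ. Qed.

Let AD f g : gamap A (f + g) = gamap A f + gamap A g.
Proof. exact: linearD. Qed.

(** The names [sym] and [anti] stand for $\epsilon=1$ and $\epsilon=-1$, and [zero], [pos], [neg]
    for the sign of $\alpha_j(wc)$. Here both equations amount to invariance, of $g$ under $s$ and
    of $Ag$ under $s'$. *)
Lemma sym_zero_iff g : A x = - x' -> gaspan S g ->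
  T g = t *: g <-> T' (gamap A g) - τ *: gamap A g = t^-1 *: gamap A g.
Proof.
move=> Ax gS; have AgS := gaspan_map AS gS; set h := gamap A g.
have e1 := divdiff_eigen S0 SB Sx sS x_tf t0 gS.
have e2 := divdiff_eigen S0 SB Sx' s'S x'_tf t0 AgS.
have e3 : gamap s g = g <-> gamap s' h = h.
  by rewrite -Asf; split=> [->|/(can_inj gaAK)].
have e4 : T' h - τ *: h = t^-1 *: h <-> T' h = t *: h.
  have tE : t *: h = t^-1 *: h + τ *: h by rewrite -scalerDl addrC subrK.
  by rewrite tE; split=> [<-|->]; rewrite ?subrK ?addrK.
by rewrite e4; split=> [/e1/e3/e2|/e2/e3/e1].
Qed.

Lemma sym_pos_iff g g' : A x = - x' -> gaspan S g ->
  gamap s g' + τ *: N g = t *: g <-> gamap A g' = T' (gamap A g).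
Proof.
move=> Ax gS; have AgS := gaspan_map AS gS.
rewrite transfer !AZ divdiff_intertwineN //.
set h := gamap A g; have -> : gamap s' (t *: h - τ *: (h - gamap s' h - N' h)) = T' h.
  rewrite !(linearB, linearZ) /= N'span // gamap_sK // /T' /τ.
  by apply/malgP => y; rewrite !(mcoeffB, mcoeffD, mcoeffN, mcoeffZ); ring.
by [].
Qed.

Lemma sym_neg_iff g g' : A x = - x' -> gaspan S g ->
  gamap s g' + τ *: (gamap s g + N g) = t *: g <->
  gamap A g' = T' (gamap A g) - τ *: gamap A g.
Proof.
move=> Ax gS; have AgS := gaspan_map AS gS.
rewrite transfer !AZ AD divdiff_intertwineN // Asf.
set h := gamap A g.
have -> : gamap s' (t *: h - τ *: (gamap s' h + (h - gamap s' h - N' h))) =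
    T' h - τ *: h.
  rewrite !(linearB, linearZ, linearD) /= N'span // gamap_sK // /T' /τ.
  by apply/malgP => y; rewrite !(mcoeffB, mcoeffD, mcoeffN, mcoeffZ); ring.
by [].
Qed.

Lemma anti_zero_iff g : A x = x' -> gaspan S g ->
  T g = - t^-1 *: g <-> T' (gamap A g) = - t^-1 *: gamap A g.
Proof.
move=> Ax gS; rewrite /T /T' -divdiff_intertwine // -Asf -!AZ -AD.
by split=> [->//|/(can_inj gaAK)].
Qed.

Lemma anti_pos_iff g g' : A x = x' -> gaspan S g ->
  gamap s g' + τ *: N g = - t^-1 *: g <->
  gamap A g' = - (T' (gamap A g) - τ *: gamap A g).
Proof.
move=> Ax gS; have AgS := gaspan_map AS gS.
rewrite transfer !AZ divdiff_intertwine //.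
set h := gamap A g; have -> : gamap s' (- t^-1 *: h - τ *: N' h) = - (T' h - τ *: h).
  rewrite !(linearB, linearZ) /= N'span // /T' /τ.
  by apply/malgP => y; rewrite !(mcoeffB, mcoeffD, mcoeffN, mcoeffZ); ring.
by [].
Qed.

Lemma anti_neg_iff g g' : A x = x' -> gaspan S g ->
  gamap s g' + τ *: (gamap s g + N g) = - t^-1 *: g <->
  gamap A g' = - T' (gamap A g).
Proof.
move=> Ax gS; have AgS := gaspan_map AS gS.
rewrite transfer !AZ AD divdiff_intertwine // Asf.
set h := gamap A g.
have -> : gamap s' (- t^-1 *: h - τ *: (gamap s' h + N' h)) = - T' h.
  rewrite !(linearB, linearZ, linearD) /= N'span // gamap_sK // /T' /τ.
  by apply/malgP => y; rewrite !(mcoeffB, mcoeffD, mcoeffN, mcoeffZ); ring.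
by [].
Qed.

End Intertwining.

(** * Consequences of the axioms of a representation on a subspace *)

Section Representation.
Context (F : fieldType) (A : algType F) (V : lmodType F) (U : set V).
Context (rho : A -> V -> V) (rhoP : is_representation U rho).
Implicit Types (a b : A) (u v : V).

Lemma repD a b v : U v -> rho (a + b) v = rho a v + rho b v.
Proof. by move=> vU; rewrite -[a]scale1r (rep_linearl rhoP) // !scale1r. Qed.

Lemma rep0 v : U v -> rho 0 v = 0.
Proof.
by move=> vU; apply: (addIr (rho 0 v)); rewrite -repD // !add0r.
Qed.

Lemma repZ k a v : U v -> rho (k *: a) v = k *: rho a v.
Proof. by move=> vU; rewrite -[k *: a]addr0 (rep_linearl rhoP) // rep0 // addr0. Qed.

Lemma repN a v : U v -> rho (- a) v = - rho a v.
Proof. by move=> vU; rewrite -[- a]scaleN1r repZ // scaleN1r. Qed.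

Lemma repB a b v : U v -> rho (a - b) v = rho a v - rho b v.
Proof. by move=> vU; rewrite repD // repN. Qed.

Lemma rep_scalar k v : U v -> rho k%:A v = k *: v.
Proof. by move=> vU; rewrite repZ // (rep1 rhoP). Qed.

Lemma rep_v0 a : U 0 -> rho a 0 = 0.
Proof.
move=> U0; have := rep_linear rhoP a 1 U0 U0.
by rewrite !scale1r addr0 => /(canLR (addrK _)); rewrite subrr.
Qed.

Lemma rep_vZ a k v : U 0 -> U v -> rho a (k *: v) = k *: rho a v.
Proof.
by move=> U0 vU; rewrite -[k *: v]addr0 (rep_linear rhoP) // rep_v0 // addr0.
Qed.

Lemma rep_vN a v : U 0 -> U v -> rho a (- v) = - rho a v.
Proof. by move=> U0 vU; rewrite -[- v]scaleN1r rep_vZ // scaleN1r. Qed.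

Lemma rep_eigen_prod (I : eqType) (s : seq I) (a : I -> A) (k : I -> F) v :
  U 0 -> U v -> {in s, forall i, rho (a i) v = k i *: v} ->
  rho (\prod_(i <- s) a i) v = (\prod_(i <- s) k i) *: v.
Proof.
move=> U0 vU; elim: s => [|i s IH] ks.
  by rewrite !big_nil (rep1 rhoP) // scale1r.
rewrite !big_cons (repM rhoP) // IH => [|j js]; last by rewrite ks // inE js orbT.
by rewrite rep_vZ // ks ?mem_head // scalerA mulrC.
Qed.

End Representation.


(** * Root systems and Weyl groups *)

Section Roots.
Context (R : realType) (E : vectType R) (dot : {dot E for @idfun R}).
Context (Phi : {fset 'Hom(E, R^o)}) (r : nat) (al : r.-tuple 'Hom(E, R^o)).
Hypothesis Phi_root : irreducible_reduced_root_system dot Phi.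
Hypothesis al_base : is_base al Phi.
Implicit Types (a b : 'Hom(E, R^o)) (u v w : 'End(E)) (x y z : E) (i j : 'I_r).

Local Notation coroot := (coroot dot).
Local Notation refl := (refl dot).
Local Notation α := (tnth al).
Local Notation s_ := (srefl dot al).

(** A boolean form of positivity, so that signs can be negated and split into cases; on roots it
    coincides with [pos_root] by [pos_rootP]. *)
Definition posr b := [forall i : 'I_r, 0 <= coord al i b].

Lemma root_nz b : b \in Phi -> b != 0.
Proof. by apply: contraTneq => ->; case: Phi_root. Qed.

Lemma al_root i : α i \in Phi.
Proof. by case: al_base => sub _ _; apply: sub; exact: mem_tnth. Qed.

Lemma al_nz i : α i != 0.
Proof. exact: root_nz (al_root i). Qed.

Lemma root_comp_refl a b : a \in Phi -> b \in Phi -> (b \o refl a)%VF \in Phi.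
Proof. by move=> aP bP; rewrite comp_refl; exact: root_refl. Qed.

Lemma rootN b : b \in Phi -> - b \in Phi.
Proof.
by move=> bP; rewrite -(comp_refl_self dot (root_nz bP)) root_comp_refl.
Qed.

Lemma coord_comb (k : 'I_r -> R) i : coord al i (\sum_j k j *: α j) = k i.
Proof.
case: al_base => _ fr _; rewrite -(coord_sum_free k i fr); congr (coord _ _ _).
by apply: eq_bigr => j _; rewrite (tnth_nth 0).
Qed.

Lemma coord_comb_nat (n : 'I_r -> nat) i :
  coord al i (\sum_j α j *+ n j) = (n i)%:R.
Proof.
rewrite -(coord_comb (fun j => (n j)%:R)); congr (coord _ _ _).
by apply: eq_bigr => j _; rewrite scaler_nat.
Qed.

Lemma coord_al i j : coord al i (α j) = (j == i)%:R.
Proof.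
by case: al_base => _ fr _; rewrite (tnth_nth 0) coord_free // eq_sym.
Qed.

Lemma root_comb b : b \in Phi -> exists n : 'I_r -> nat,
  b = \sum_j α j *+ n j \/ b = - \sum_j α j *+ n j.
Proof. by case: al_base => _ _; apply. Qed.

Lemma coord_eq0 b : b \in Phi -> (forall i, coord al i b = 0) -> False.
Proof.
move=> bP b0; have /eqP [] := root_nz bP.
have [n bE] := root_comb bP.
have n0 i : n i = 0%N.
  apply/eqP; rewrite -(pnatr_eq0 R); move: (b0 i).
  by case: bE => ->; rewrite ?linearN /= coord_comb_nat => /eqP; rewrite ?oppr_eq0.
by case: bE => ->; rewrite big1 ?oppr0 // => i _; rewrite n0 mulr0n.
Qed.

Lemma root_coord_sign b : b \in Phi -> posr b \/ forall i, coord al i b <= 0.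
Proof.
move=> /root_comb [n [] ->]; [left; apply/forallP|right] => i.
  by rewrite coord_comb_nat.
by rewrite linearN /= coord_comb_nat oppr_le0.
Qed.

Lemma posrN b : b \in Phi -> posr (- b) = ~~ posr b.
Proof.
move=> bP; apply/idP/idP.
  move=> /forallP nb; apply/negP => /forallP pb; apply: (coord_eq0 bP) => i.
  by apply/eqP; rewrite eq_le pb -oppr_ge0 -linearN nb.
case: (root_coord_sign bP) => [-> //|nb _]; apply/forallP => i.
by rewrite linearN /= oppr_ge0.
Qed.

Lemma posr_al i : posr (α i).
Proof. by apply/forallP => j; rewrite coord_al. Qed.

Lemma posr_comb b : b \in Phi -> posr b ->
  exists n : 'I_r -> nat, b = \sum_j α j *+ n j.
Proof.
move=> bP pb; have [n [bE|bE]] := root_comb bP; exists n => //.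
have : posr (- b).
  by apply/forallP => i; rewrite bE opprK coord_comb_nat.
by rewrite posrN // pb.
Qed.

Lemma pos_rootP b : pos_root al Phi b <-> b \in Phi /\ posr b.
Proof.
split=> [[bP [n bE]]|[bP pb]]; split=> //; last exact: posr_comb.
by apply/forallP => i; rewrite bE coord_comb_nat.
Qed.

(** Otherwise $b$ would be a positive multiple of $\alpha_i$, and reducedness would make it
    $\alpha_i$. *)
Lemma posr_other b i : b \in Phi -> posr b -> b != α i ->
  exists2 j, j != i & 0 < coord al j b.
Proof.
move=> bP pb bi; apply: contrapT => h.
have b0 j : j != i -> coord al j b = 0.
  move=> ji; apply/eqP; move/forallP: (pb) => /(_ j).
  by rewrite le0r; case/orP => // j0; case: h; exists j.
have [n bE] := posr_comb bP pb.
have bE' : b = (n i)%:R *: α i.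
  rewrite bE (bigD1 i) //= big1 ?addr0 ?scaler_nat // => j /b0.
  by rewrite bE coord_comb_nat => /eqP; rewrite pnatr_eq0 => /eqP->.
have kP : (n i)%:R *: α i \in Phi by rewrite -bE'.
case: (root_reduced Phi_root (al_root i) kP) => n1.
  by move: bi; rewrite bE' n1 scale1r eqxx.
by have := ler0n R (n i); rewrite n1 oppr_ge0 ler10.
Qed.

(** The reflection changes only the $i$-th coordinate, so a positive coordinate elsewhere survives
    and fixes the sign of the root. *)
Lemma posr_comp_simple b i : b \in Phi -> posr b -> b != α i ->
  posr (b \o s_ i)%VF.
Proof.
move=> bP pb bi; have [j ji bj] := posr_other bP pb bi.
have bsP : (b \o s_ i)%VF \in Phi by apply: root_comp_refl => //; exact: al_root.
case: (root_coord_sign bsP) => // /(_ j); rewrite comp_refl linearB linearZ /=.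
by rewrite coord_al eq_sym (negPf ji) mulr0 subr0 leNgt bj.
Qed.

Lemma srefl_al i : (α i \o s_ i)%VF = - α i.
Proof. exact: comp_refl_self (al_nz i). Qed.

Lemma sreflK i : involutive (s_ i).
Proof. exact: reflK (al_nz i). Qed.

Lemma srefl_compK i : (s_ i \o s_ i)%VF = \1%VF.
Proof. exact: refl_compK (al_nz i). Qed.

Lemma srefl_compKl i v : (s_ i \o (s_ i \o v))%VF = v.
Proof. by rewrite comp_lfunA srefl_compK comp_lfun1l. Qed.

Lemma corootMn_neq0 i n : coroot (α i) *+ n.+1 != 0.
Proof.
rewrite -scaler_nat scaler_eq0 negb_or pnatr_eq0 /=.
exact: coroot_neq0 (al_nz i).
Qed.

Local Notation word_prod := (word_prod dot al).
Local Notation weyl := (weyl dot Phi).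

Let ht b := \sum_i coord al i b.

Let ht_comb (n : 'I_r -> nat) : ht (\sum_j α j *+ n j) = (\sum_j n j)%:R.
Proof.
by rewrite natr_sum; apply: eq_bigr => i _; rewrite coord_comb_nat.
Qed.

Lemma word_prod_cat s s' :
  word_prod (s ++ s') = (word_prod s \o word_prod s')%VF.
Proof.
by elim: s => [|i s IH] /=; rewrite ?comp_lfun1l // IH comp_lfunA.
Qed.

Lemma word_prod_rev s : (word_prod (rev s) \o word_prod s)%VF = \1%VF.
Proof.
elim: s => [|i s IH] /=; first by rewrite comp_lfun1l.
rewrite rev_cons -cats1 word_prod_cat /= comp_lfun1r -comp_lfunA.
by rewrite srefl_compKl.
Qed.

Lemma word_prod_revK s : cancel (word_prod s) (word_prod (rev s)).
Proof. by move=> x; rewrite -comp_lfunE word_prod_rev id_lfunE. Qed.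

Lemma word_prod_ker s : lker (word_prod s) == 0%VS.
Proof. exact/lker0P/(can_inj (word_prod_revK s)). Qed.

Lemma word_prodV s : (word_prod s)^-1%VF = word_prod (rev s).
Proof.
have := word_prod_rev s => /(congr1 (fun v => v \o (word_prod s)^-1)%VF).
by rewrite (lker0_compfK (word_prod_ker s)) comp_lfun1l.
Qed.

Lemma word_isometry s x y : dot (word_prod s x) (word_prod s y) = dot x y.
Proof.
elim: s => [|i s IH] /=; first by rewrite !id_lfunE.
by rewrite !comp_lfunE refl_isometry // al_nz.
Qed.

Lemma refl_simple_comp b i :
  refl (b \o s_ i)%VF = (s_ i \o refl b \o s_ i)%VF.
Proof.
apply: refl_comp; try exact: sreflK.
by move=> y z; apply: refl_isometry; exact: al_nz.
Qed.

(** Induction on the height of a positive root. Some simple root pairs positively with $b$, since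
    otherwise $b(b^\vee)\le0$; unless $b$ is simple, the corresponding reflection keeps $b$ positive
    and lowers its height, and conjugation carries the word back. *)
Lemma refl_word b : b \in Phi -> exists s, refl b = word_prod s.
Proof.
move=> bP; wlog pb : b bP / posr b => [h|].
  have [/(h _ bP)//|nb] := boolP (posr b).
  rewrite -reflN; apply: h; first exact: rootN.
  by rewrite posrN.
have [n bE] := posr_comb  bP pb.
have [N] := ubnP (\sum_j n j); elim: N b n bP pb bE => // N IH b n bP pb bE nN.
have [/existsP[i /eqP->]|] := boolP [exists i, b == α i].
  by exists [:: i]; rewrite /= comp_lfun1r.
rewrite negb_exists => /forallP bs.
have [i bi] : exists i, 0 < b (coroot (α i)).
  apply: contrapT => h.
  have : b (coroot b) <= 0.
    rewrite bE sum_lfunE -bE; apply: sumr_le0 => i _.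
    rewrite -scaler_nat scale_lfunE; apply: mulr_ge0_le0; rewrite // leNgt.
    apply/negP => ib; apply: h; exists i.
    by rewrite (pairing_gt0C dot (al_nz i) (root_nz bP)).
  by rewrite pairing_self ?root_nz // lern0.
have bsP : (b \o s_ i)%VF \in Phi.
  by apply: root_comp_refl => //; exact: al_root.
have pbs := posr_comp_simple  bP pb (bs i).
have [n' bsE] := posr_comb  bsP pbs.
have [|s rs] := IH _ n' bsP pbs bsE.
  rewrite -ltnS; apply: leq_trans nN; rewrite ltnS -(ltr_nat R) -!ht_comb -bsE.
  rewrite comp_refl -bE /ht -subr_gt0 -sumrB (bigD1 i) //= big1 => [|j ji].
    rewrite addr0 linearB linearZ /= coord_al eqxx mulr1.
    by rewrite opprB addrC subrK.
  by rewrite linearB linearZ /= coord_al eq_sym (negPf ji) mulr0 subr0 subrr.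
exists (i :: rcons s i); rewrite -cats1 -cat1s !word_prod_cat -rs.
rewrite refl_simple_comp /= !comp_lfun1r -!comp_lfunA.
by rewrite !srefl_compKl srefl_compK comp_lfun1r.
Qed.

Lemma weyl_word s : weyl (word_prod s).
Proof.
exists (map α s); last by elim: s => //= i s ->.
by move=> _ /mapP[i _ ->]; exact: al_root.
Qed.

Lemma weylP w : weyl w -> exists s, w = word_prod s.
Proof.
case=> s; elim: s w => [|b s IH] w /= sP ->; first by exists [::].
have [t bE] : exists t, refl b = word_prod t by apply/refl_word/sP/mem_head.
have [|t' ->] := IH _ _ erefl; first by move=> a aP; apply: sP; rewrite inE aP orbT.
by exists (t ++ t'); rewrite word_prod_cat bE.
Qed.

Lemma weyl1 : weyl \1%VF. Proof. exact: (weyl_word [::]). Qed.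

Lemma weylM u v : weyl u -> weyl v -> weyl (u \o v)%VF.
Proof.
by move=> /weylP[s ->] /weylP[s' ->]; rewrite -word_prod_cat; exact: weyl_word.
Qed.

Lemma weyl_simple i : weyl (s_ i).
Proof. by have := weyl_word [:: i]; rewrite /= comp_lfun1r. Qed.

Lemma weylV w : weyl w -> weyl w^-1%VF.
Proof. by move=> /weylP[s ->]; rewrite word_prodV; exact: weyl_word. Qed.

Lemma weyl_ker w : weyl w -> lker w == 0%VS.
Proof. by move=> /weylP[s ->]; exact: word_prod_ker. Qed.

Lemma weyl_root w b : weyl w -> b \in Phi -> (b \o w)%VF \in Phi.
Proof.
move=> /weylP[s ->]; elim: s b => [|i s IH] b bP /=; first by rewrite comp_lfun1r.
rewrite comp_lfunA; apply/IH/root_comp_refl => //.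
exact: al_root.
Qed.

Lemma weyl_isometry w x y : weyl w -> dot (w x) (w y) = dot x y.
Proof. by move=> /weylP[s ->]; exact: word_isometry. Qed.

Lemma refl_weyl_comp w b : weyl w ->
  refl (b \o w)%VF = (w^-1 \o refl b \o w)%VF.
Proof.
move=> wW; apply: refl_comp.
- by move=> y z; apply: weyl_isometry.
- exact: lker0_lfunVK (weyl_ker wW).
- exact: lker0_lfunK (weyl_ker wW).
Qed.

Lemma coroot_weyl_comp w b : weyl w -> coroot (b \o w)%VF = w^-1%VF (coroot b).
Proof.
move=> wW; apply: coroot_comp.
- by move=> y z; apply: weyl_isometry.
- exact: lker0_lfunVK (weyl_ker wW).
- exact: lker0_lfunK (weyl_ker wW).
Qed.

(** * Length *)

Local Notation reduced_expr := (reduced_expr dot al).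
Local Notation red_word := (red_word dot al).
Local Notation len := (len dot al).

(** As the letters of [s] act on $b$ one after the other, the root can turn negative only at a
    letter whose simple root it has become; deleting that letter amounts to multiplying by the
    reflection in $b$. *)
Lemma exchange s b : b \in Phi -> posr b -> ~~ posr (b \o word_prod s)%VF ->
  exists s', size s = (size s').+1 /\
    word_prod s' = (refl b \o word_prod s)%VF.
Proof.
elim: s b => [|i s IH] b bP pb /=; first by rewrite comp_lfun1r pb.
have [->|bi] := eqVneq b (α i).
  by move=> _; exists s; split; rewrite // srefl_compKl.
rewrite comp_lfunA => nb.
have bsP : (b \o s_ i)%VF \in Phi by apply: root_comp_refl (al_root i) _.
have [|s' [ss' s'E]] := IH _ bsP _ nb; first exact: posr_comp_simple.
exists (i :: s'); rewrite /= ss' s'E; split=> //.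
by rewrite refl_simple_comp !comp_lfunA srefl_compK comp_lfun1l.
Qed.

Lemma red_wordP w : weyl w -> reduced_expr w (red_word w).
Proof.
move=> /weylP[s0 s0w]; apply: xgetPex.
have [n] := ubnP (size s0); elim: n s0 s0w => // n IH s sw sn.
have [h|] := pselect (forall s', word_prod s' = w -> (size s <= size s')%N).
  by exists s; split.
move=> /existsNP[s' /not_implyP[s'w /negP]]; rewrite -ltnNge => s's.
by apply: (IH s') => //; apply: leq_trans s's _.
Qed.

Lemma red_wordK w : weyl w -> word_prod (red_word w) = w.
Proof. by move=> /red_wordP[]. Qed.

Lemma len_word s : (len (word_prod s) <= size s)%N.
Proof. by have [_] := red_wordP (weyl_word s); apply. Qed.

Lemma len_simple_le w i : weyl w -> (len (s_ i \o w)%VF <= (len w).+1)%N.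
Proof.
by move=> wW; rewrite -{1}(red_wordK wW); exact: (len_word (i :: red_word w)).
Qed.

(** Negativity of [α i \o w], which is $w^{-1}\alpha_i$, marks a left descent: the exchange property
    deletes a letter from a reduced word of $w$. *)
Lemma len_desc w i : weyl w -> ~~ posr (α i \o w)%VF ->
  len w = (len (s_ i \o w)%VF).+1.
Proof.
move=> wW nw; apply/eqP; rewrite eqn_leq; apply/andP; split.
  rewrite -{1}(srefl_compKl i w).
  by apply: len_simple_le; apply: weylM (weyl_simple i) wW.
have := nw; rewrite -{1}(red_wordK wW).
case/(exchange (al_root i) (posr_al i)) => s [ss sE].
by rewrite [len w]ss ltnS -{1}(red_wordK wW) -sE len_word.
Qed.

Lemma posr_simple_comp w i : weyl w ->
  posr (α i \o (s_ i \o w))%VF = ~~ posr (α i \o w)%VF.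
Proof.
move=> wW; rewrite comp_lfunA srefl_al comp_lfunNl posrN //.
exact: weyl_root (al_root i).
Qed.

Lemma len_asc w i : weyl w -> posr (α i \o w)%VF ->
  len (s_ i \o w)%VF = (len w).+1.
Proof.
move=> wW pw; rewrite -{2}(srefl_compKl i w); apply: len_desc.
  exact: weylM (weyl_simple i) wW.
by rewrite posr_simple_comp // pw.
Qed.

Lemma odd_len_simple w i : weyl w -> odd (len (s_ i \o w)%VF) = ~~ odd (len w).
Proof.
move=> wW; have [pw|nw] := boolP (posr (α i \o w)%VF); first by rewrite len_asc.
by rewrite (len_desc wW nw) /= negbK.
Qed.

(** Needed to identify the sign $(-1)^{l(w_0)+l(w)}$ with the sign of $w_0w$ in [twist_elt]. *)
Lemma odd_lenM u v : weyl u -> weyl v ->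
  odd (len (u \o v)%VF) = odd (len u) (+) odd (len v).
Proof.
move=> /weylP[s ->] vW; elim: s => [|i s IH] /=.
  have /eqP -> : len \1%VF == 0%N by rewrite -leqn0; exact: (len_word [::]).
  by rewrite comp_lfun1l.
have sW := weyl_word s.
by rewrite -comp_lfunA !odd_len_simple ?IH ?addNb //; exact: weylM.
Qed.

Lemma weylK w : weyl w -> cancel w w^-1%VF.
Proof. by move=> /weyl_ker /lker0_lfunK. Qed.

Lemma weylVK w : weyl w -> cancel w^-1%VF w.
Proof. by move=> /weyl_ker /lker0_lfunVK. Qed.

Lemma weyl_compV w : weyl w -> (w^-1 \o w)%VF = \1%VF.
Proof. by move=> /weyl_ker /lker0_compVf. Qed.

Lemma weyl_compfV w : weyl w -> (w \o w^-1)%VF = \1%VF.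
Proof. by move=> /weyl_ker /lker0_compfV. Qed.

Lemma weyl_compI w u v : weyl w -> (w \o u)%VF = (w \o v)%VF -> u = v.
Proof.
move=> wW /(congr1 (fun f => (w^-1 \o f)%VF)).
by rewrite !comp_lfunA weyl_compV // !comp_lfun1l.
Qed.

Lemma weyl_comIp w (a b : 'Hom(E, R^o)) :
  weyl w -> (a \o w)%VF = (b \o w)%VF -> a = b.
Proof.
move=> wW /(congr1 (fun f => (f \o w^-1)%VF)).
by rewrite -!comp_lfunA weyl_compfV // !comp_lfun1r.
Qed.

Lemma weyl_inv_eq w v : weyl w -> (v \o w)%VF = \1%VF -> w^-1%VF = v.
Proof.
move=> wW /(congr1 (fun f => (f \o w^-1)%VF)).
by rewrite -comp_lfunA weyl_compfV // comp_lfun1r comp_lfun1l.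
Qed.

Lemma weylVV w : weyl w -> (w^-1)^-1%VF = w.
Proof. by move=> wW; apply: weyl_inv_eq (weylV wW) _; exact: weyl_compfV. Qed.

Lemma weylMV u v : weyl u -> weyl v -> ((u \o v)^-1 = v^-1 \o u^-1)%VF.
Proof.
move=> uW vW; apply: weyl_inv_eq; first exact: weylM.
by rewrite -comp_lfunA (comp_lfunA u^-1%VF) weyl_compV // comp_lfun1l weyl_compV.
Qed.

Lemma simpleV i : (s_ i)^-1%VF = s_ i.
Proof. by apply: weyl_inv_eq (weyl_simple i) _; exact: srefl_compK. Qed.

Lemma lenV w : weyl w -> len w^-1%VF = len w.
Proof.
have le v : weyl v -> (len v^-1%VF <= len v)%N.
  move=> vW; rewrite -{1}(red_wordK vW) word_prodV.
  by rewrite (leq_trans (len_word _)) // size_rev.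
by move=> wW; apply/eqP; rewrite eqn_leq le // -{1}(weylVV wW) le //; exact: weylV.
Qed.

(** The first letter of a nonempty reduced word would be a left descent. *)
Lemma weyl_pos_eq1 w : weyl w -> (forall i, posr (α i \o w)%VF) -> w = \1%VF.
Proof.
move=> wW pw; rewrite -(red_wordK wW).
case sE: (red_word w) => [//|i s].
have := len_asc wW (pw i); rewrite -{1}(red_wordK wW) sE /= srefl_compKl => lw.
by have := len_word s; rewrite lw /len sE /= => /ltnW; rewrite ltnn.
Qed.

Lemma comp_suml (n : 'I_r -> nat) (w : 'End(E)) :
  ((\sum_j α j *+ n j) \o w = \sum_j (α j \o w) *+ n j)%VF.
Proof.
apply/lfunP => x; rewrite comp_lfunE !sum_lfunE; apply: eq_bigr => i _.
by rewrite -!scaler_nat !scale_lfunE comp_lfunE.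
Qed.

Lemma posr_comp w b : weyl w -> b \in Phi -> posr b ->
  (forall i, 0 < coord al i b -> posr (α i \o w)%VF) -> posr (b \o w)%VF.
Proof.
move=> wW bP pb h; have [n bE] := posr_comb bP pb; apply/forallP => j.
rewrite bE comp_suml linear_sum /=; apply: sumr_ge0 => i _.
rewrite raddfMn /=; have [->//|ni] := eqVneq (n i) 0%N.
have /h /forallP pi : 0 < coord al i b by rewrite bE coord_comb_nat ltr0n lt0n.
by apply: mulrn_wge0; exact: pi.
Qed.

(** Coordinates of positive roots cannot cancel, so a summand that contributes to the $j$-th
    coordinate has no other one and must be $\alpha_j$. *)
Lemma simple_indecomposable (n : 'I_r -> nat) (g : 'I_r -> 'Hom(E, R^o)) j :
  (forall i, n i != 0%N -> g i \in Phi /\ posr (g i)) ->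
  \sum_i g i *+ n i = α j -> exists2 i, n i != 0%N & g i = α j.
Proof.
move=> gP gE.
have cE k : \sum_i coord al k (g i) *+ n i = (j == k)%:R.
  by rewrite -(coord_al k j) -gE linear_sum /=; apply: eq_bigr => i _; rewrite raddfMn.
have ge0 k i : 0 <= coord al k (g i) *+ n i.
  have [->|/gP[_ /forallP pg]] := eqVneq (n i) 0%N; first by rewrite mulr0n.
  exact: mulrn_wge0.
have [i gi] : exists i, coord al j (g i) *+ n i != 0.
  apply: contrapT => h; have := cE j; rewrite eqxx big1 => [/esym/eqP|i _].
    by rewrite oner_eq0.
  by apply/eqP/negP => /negP ?; apply: h; exists i.
have ni : n i != 0%N by apply: contraNneq gi => ->; rewrite mulr0n.
exists i => //; have [giP pgi] := gP i ni.
apply/eqP/negP => /negP /(posr_other giP pgi)[k kj gk].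
have := cE k; rewrite eq_sym (negPf kj) => /eqP; rewrite psumr_eq0 // => /allP.
move=> /(_ i (mem_index_enum _)) /=; rewrite mulrn_eq0 (negPf ni) /=.
by rewrite gt_eqF.
Qed.

Lemma posr_comp_eq_simple w b j : weyl w -> b \in Phi -> posr b ->
  (forall i, 0 < coord al i b -> posr (α i \o w)%VF) ->
  (b \o w)%VF = α j -> exists i, b = α i.
Proof.
move=> wW bP pb h bj; have [n bE] := posr_comb bP pb.
have [||i ni ij] := @simple_indecomposable n (fun i => α i \o w)%VF j.
- move=> i ni; split; first exact: weyl_root (al_root i).
  by apply: h; rewrite bE coord_comb_nat ltr0n lt0n.
- by rewrite -comp_suml -bE.
by exists i; apply: (weyl_comIp wW); rewrite ij.
Qed.

(** * Matsumoto's theorem *)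

Fixpoint alt_word (m : nat) (i j : 'I_r) : seq 'I_r :=
  if m is n.+1 then i :: alt_word n j i else [::].

Lemma size_alt_word m i j : size (alt_word m i j) = m.
Proof. by elim: m i j => //= m IH i j; rewrite IH. Qed.

Lemma prod_alt_word (B : pzRingType) (T : 'I_r -> B) m i j :
  \prod_(k <- alt_word m i j) T k = altprod m (T i) (T j).
Proof.
by elim: m i j => [|m IH] i j /=; rewrite ?big_nil // big_cons IH.
Qed.

Lemma alt_word_prefix m n i j :
  exists2 t, size t = n & alt_word (m + n) i j = alt_word m i j ++ t.
Proof.
elim: m i j => [|m IH] i j; first by exists (alt_word n i j); rewrite ?size_alt_word.
by have [t st tE] := IH j i; exists t; rewrite //= tE.
Qed.

Let pow (g : 'End(E)) k := iter k (fun h => (g \o h)%VF) \1%VF.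

Lemma pow_rot (u v : 'End(E)) k :
  (u \o pow (v \o u) k \o v = pow (u \o v) k.+1)%VF.
Proof.
elim: k => [|k IH] /=; first by rewrite comp_lfun1r comp_lfun1r.
by move: IH; rewrite /= -!comp_lfunA => <-.
Qed.

Lemma alt_word_rev k i j :
  (word_prod (alt_word k i j) \o word_prod (rev (alt_word k j i)))%VF =
  pow (s_ i \o s_ j)%VF k.
Proof.
elim: k i j => [|k IH] i j; first by rewrite /= comp_lfun1l.
rewrite -pow_rot -IH /= rev_cons -cats1 word_prod_cat /= comp_lfun1r.
by rewrite !comp_lfunA.
Qed.

(** Multiplying by the inverse of the second alternating word turns the braid relation of length $k$
    into the condition that [is_order] speaks of. *)
Lemma alt_word_pow k i j :
  word_prod (alt_word k i j) = word_prod (alt_word k j i) <->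
  pow (s_ i \o s_ j)%VF k = \1%VF.
Proof.
rewrite -alt_word_rev; split=> [->|].
  by have := word_prod_rev (rev (alt_word k j i)); rewrite revK.
move=> /(congr1 (fun f => f \o word_prod (alt_word k j i))%VF).
by rewrite -comp_lfunA word_prod_rev comp_lfun1r comp_lfun1l.
Qed.

(** Once a left descent has been stripped it is no longer one, so only the other of the two letters
    can be next; this forces the stripped word to alternate. *)
Lemma strip_alt w i j : weyl w -> posr (α j \o w)%VF -> exists k u,
  [/\ weyl u, w = (word_prod (alt_word k i j) \o u)%VF, len w = (k + len u)%N,
      posr (α i \o u)%VF & posr (α j \o u)%VF].
Proof.
have [n] := ubnP (len w); elim: n w i j => // n IH w i j wn wW pj.
have [pi|ni] := boolP (posr (α i \o w)%VF).
  by exists 0%N, w; split; rewrite //= comp_lfun1l.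
have lw := len_desc wW ni; have siW := weylM (weyl_simple i) wW.
have [||k [u [uW wE lu pju piu]]] := IH (s_ i \o w)%VF j i _ siW.
- by rewrite lw in wn; rewrite -ltnS; apply: leq_trans wn _.
- by rewrite posr_simple_comp.
exists k.+1, u; split=> //; last by rewrite lw lu.
by rewrite /= -comp_lfunA -wE srefl_compKl.
Qed.

Lemma coord_dihedral (s : seq 'I_r) i j b l : {subset s <= [:: i; j]} ->
  l \notin [:: i; j] -> coord al l (b \o word_prod s)%VF = coord al l b.
Proof.
move=> sij lij; elim: s b sij => [|k s IH] b sij /=; first by rewrite comp_lfun1r.
rewrite comp_lfunA IH => [|m ms]; last by apply: sij; rewrite inE ms orbT.
rewrite comp_refl linearB linearZ /= coord_al.
have [kl|] := eqVneq k l; last by rewrite mulr0 subr0.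
by move: lij; rewrite -kl sij ?mem_head.
Qed.

(** If [word_prod s] were nontrivial it would make some $\alpha_k$ negative. Coordinates outside
    $i,j$ do not change, so $k$ is $i$ or $j$ and the negative root is supported there; $u'$ keeps
    it negative, against positivity of [α k \o u]. *)
Lemma dihedral_coset_unique (s : seq 'I_r) i j u u' : {subset s <= [:: i; j]} ->
  weyl u' -> (forall k, k \in [:: i; j] -> posr (α k \o u)%VF) ->
  (forall k, k \in [:: i; j] -> posr (α k \o u')%VF) ->
  u = (word_prod s \o u')%VF -> u = u'.
Proof.
move=> sij u'W pu pu' uE; have sW := weyl_word s.
suff s1 : word_prod s = \1%VF by rewrite uE s1 comp_lfun1l.
apply: (weyl_pos_eq1 sW) => k; apply/contraT => nk.
have kP : (α k \o word_prod s)%VF \in Phi by apply: weyl_root (al_root k).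
have [kij|kij] := boolP (k \in [:: i; j]); last first.
  have [pk|/(_ k)] := root_coord_sign kP; first by rewrite pk in nk.
  by rewrite (coord_dihedral _ sij kij) coord_al eqxx ler10.
have := pu _ kij; rewrite uE comp_lfunA -[posr _]negbK -posrN; last first.
  exact: weyl_root kP.
rewrite -comp_lfunNl posr_comp ?rootN ?posrN // => l.
rewrite linearN /= oppr_gt0 => sl; apply: pu'; apply/contraT => lij.
move: sl; rewrite (coord_dihedral _ sij lij) coord_al.
have [kl|_] := eqVneq k l; first by rewrite kl (negPf lij) in kij.
by rewrite ltxx.
Qed.

Lemma alt_word_sub k i j : {subset alt_word k i j <= [:: i; j]}.
Proof.
elim: k i j => [|k IH] i j l //=; rewrite inE => /orP[/eqP->|/IH].
  by rewrite mem_head.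
by rewrite !inE orbC.
Qed.

Lemma strip_desc w i j : weyl w -> ~~ posr (α i \o w)%VF -> exists k u,
  [/\ weyl u, w = (word_prod (alt_word k.+1 i j) \o u)%VF,
      len w = (k.+1 + len u)%N, posr (α i \o u)%VF & posr (α j \o u)%VF].
Proof.
move=> wW ni; have siW := weylM (weyl_simple i) wW.
have [|k [u [uW wE lu pju piu]]] := @strip_alt (s_ i \o w)%VF j i siW.
  by rewrite posr_simple_comp.
exists k, u; split=> //; first by rewrite /= -comp_lfunA -wE srefl_compKl.
by rewrite (len_desc wW ni) lu.
Qed.

(* Both ways of stripping letters s_i, s_j from the left of w end at the
   shortest element of the coset of w modulo the dihedral group <s_i, s_j>. *)
Lemma dihedral_factor w i j : weyl w -> i != j ->
  ~~ posr (α i \o w)%VF -> ~~ posr (α j \o w)%VF -> exists k u,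
  [/\ weyl u, is_order (s_ i \o s_ j)%VF k.+1, len w = (k.+1 + len u)%N,
      w = (word_prod (alt_word k.+1 i j) \o u)%VF &
      w = (word_prod (alt_word k.+1 j i) \o u)%VF].
Proof.
move=> wW ij ni nj.
have [k [u [uW wE lu piu pju]]] := strip_desc j wW ni.
have [k' [u' [u'W wE' lu' pju' piu']]] := strip_desc i wW nj.
pose s := rev (alt_word k.+1 i j) ++ alt_word k'.+1 j i.
have uu' : u = u'.
  apply: (@dihedral_coset_unique s i j) => //.
  - move=> l; rewrite mem_cat mem_rev => /orP[/alt_word_sub//|/alt_word_sub].
    by rewrite !inE orbC.
  - by move=> l; rewrite !inE => /orP[]/eqP->.
  - by move=> l; rewrite !inE => /orP[]/eqP->.
  - rewrite word_prod_cat -comp_lfunA -wE' wE comp_lfunA word_prod_rev.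
    by rewrite comp_lfun1l.
subst u'; have kk' : k = k' by apply/eqP; rewrite -eqSS -(eqn_add2r (len u)) -lu lu'.
subst k'; exists k, u; split=> //.
have altE : word_prod (alt_word k.+1 i j) = word_prod (alt_word k.+1 j i).
  have := etrans (esym wE) wE' => /(congr1 (fun f => f \o u^-1)%VF).
  by rewrite -!comp_lfunA weyl_compfV // !comp_lfun1r.
split=> //; first by have [h _] := alt_word_pow k.+1 i j; exact: h.
(* If already $(s_is_j)^{m+1}=1$ with $m+1\le k$, the alternating prefix of length $m+2$ could be
   replaced by one of length $m$, and $w$ would be shorter than its length. *)
case=> // m /andP[_ mk] powm; have [_ /(_ powm) mE] := alt_word_pow m.+1 i j.
have [t st tE] := alt_word_prefix m.+2 (k.+1 - m.+2) i j.
rewrite subnKC // in tE.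
have lew : (len w <= m + (k.+1 - m.+2) + len u)%N.
  rewrite -{1}(red_wordK uW) in wE.
  rewrite {1}wE tE -st word_prod_cat.
  have -> : word_prod (alt_word m.+2 i j) = word_prod (alt_word m j i).
    by rewrite -[LHS]/(s_ i \o word_prod (alt_word m.+1 j i))%VF -mE /= srefl_compKl.
  by rewrite -!word_prod_cat (leq_trans (len_word _)) // !size_cat size_alt_word.
move: lew; rewrite lu leq_add2r leqNgt; case/negP.
lia.
Qed.

(** Induction on the length. Distinct first letters $i,j$ are both left descents, so
    [dihedral_factor] gives reduced words beginning with the two alternating words. The induction
    hypothesis compares each given word with one of them after the common first letter, and a braid
    relation links the two. *)
Lemma matsumoto (B : pzRingType) (T : 'I_r -> B) :
  (forall i j m, i != j -> is_order (s_ i \o s_ j)%VF m ->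
     altprod m (T i) (T j) = altprod m (T j) (T i)) ->
  forall s s', word_prod s = word_prod s' ->
    len (word_prod s) = size s -> size s = size s' ->
    \prod_(i <- s) T i = \prod_(i <- s') T i.
Proof.
move=> braid s s'; have [n] := ubnP (size s).
elim: n s s' => // n IH [|i s] [|j s'] //= sn sE ls [ss'].
have sW := weyl_word s; have s'W := weyl_word s'.
have desc k t : word_prod (k :: t) = (s_ i \o word_prod s)%VF -> size t = size s ->
    ~~ posr (α k \o (s_ i \o word_prod s))%VF.
  move=> tE st; rewrite -tE /= posr_simple_comp ?negbK; last exact: weyl_word.
  apply/contraT => /(len_desc (weyl_word t)) lt.
  have lw : len (s_ k \o word_prod t)%VF = (size s).+1.
    by rewrite -[(_ \o _)%VF]/(word_prod (k :: t)) tE ls.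
  by have := len_word t; rewrite lt lw st; lia.
have wW : weyl (s_ i \o word_prod s)%VF by apply: weylM (weyl_simple i) sW.
have step k t t' : (size t < n)%N ->
    word_prod (k :: t) = (s_ i \o word_prod s)%VF -> size t = size s ->
    size t' = size s -> word_prod (k :: t') = (s_ i \o word_prod s)%VF ->
    \prod_(i <- t) T i = \prod_(i <- t') T i.
  move=> tn tE ts t's t'E; apply: IH => //; last by rewrite ts t's.
    by apply: (weyl_compI (weyl_simple k)); rewrite -[LHS]/(word_prod (k :: t)) tE -t'E.
  apply/eqP; rewrite eqn_leq len_word /= -ltnS ts -ls -tE /=.
  by apply: len_simple_le; exact: weyl_word.
have [ij|ij] := eqVneq i j.
  rewrite !big_cons -ij; congr (_ * _); apply: (step i) => //.
  by rewrite ij -[LHS]sE ij.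
have [k [u [uW ord lw wi wj]]] := dihedral_factor wW ij (desc i s erefl erefl)
  (desc j s' (esym sE) (esym ss')).
pose su := red_word u.
have su_size : (k + size su)%N = size s by apply: succn_inj; rewrite -ls lw.
have -> : \prod_(l <- i :: s) T l = \prod_(l <- alt_word k.+1 i j ++ su) T l.
  rewrite !big_cons; congr (_ * _); apply: (step i) => //.
    by rewrite size_cat size_alt_word.
  rewrite -cat_cons -[i :: alt_word k j i]/(alt_word k.+1 i j).
  by rewrite word_prod_cat red_wordK.
have -> : \prod_(l <- j :: s') T l = \prod_(l <- alt_word k.+1 j i ++ su) T l.
  rewrite !big_cons; congr (_ * _); apply: (step j) => //; rewrite -?ss' //.
    by rewrite size_cat size_alt_word.
  rewrite -cat_cons -[j :: alt_word k i j]/(alt_word k.+1 j i).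
  by rewrite word_prod_cat red_wordK.
by rewrite !big_cat !prod_alt_word braid.
Qed.

(** * Minimal coset representatives and the longest element *)

Section Dominant.
Variable c : E.
Hypothesis c_dom : forall i, 0 <= α i c.

Local Notation stab := (stab dot Phi c).
Local Notation Wc := (min_reps dot al Phi c).

Lemma posr_dom b : b \in Phi -> posr b -> 0 <= b c.
Proof.
move=> bP /(posr_comb bP)[n ->]; rewrite sum_lfunE; apply: sumr_ge0 => i _.
by rewrite -scaler_nat scale_lfunE mulr_ge0.
Qed.

Lemma dom_gt0_posr b : b \in Phi -> 0 < b c -> posr b.
Proof.
move=> bP b0; rewrite -[posr b]negbK -posrN //; apply/negP => /posr_dom.
by move=> /(_ (rootN bP)); rewrite opp_lfunE oppr_ge0 leNgt b0.
Qed.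

Lemma dom_lt0_posr b : b \in Phi -> b c < 0 -> ~~ posr b.
Proof. by move=> bP b0; apply/negP => /(posr_dom bP); rewrite leNgt b0. Qed.

Lemma dom_support b i : b \in Phi -> posr b -> b c = 0 -> 0 < coord al i b ->
  α i c = 0.
Proof.
move=> bP pb; have [n bE] := posr_comb bP pb.
rewrite [in coord _ _ _]bE coord_comb_nat ltr0n lt0n bE sum_lfunE => /eqP.
rewrite psumr_eq0 => [/allP /(_ i (mem_index_enum _)) /=|j _]; last first.
  by rewrite -scaler_nat scale_lfunE mulr_ge0.
rewrite -scaler_nat scale_lfunE mulf_eq0 pnatr_eq0 => /orP[->//|/eqP //].
Qed.

Lemma srefl_fix i : s_ i c = c <-> α i c = 0.
Proof. exact: refl_fix (al_nz i). Qed.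

Lemma stab_simple i : α i c = 0 -> stab (s_ i).
Proof. by move=> /srefl_fix; split; first exact: weyl_simple. Qed.

Lemma stabV v : stab v -> stab v^-1%VF.
Proof. by case=> vW vc; split; [exact: weylV|rewrite -{1}vc weylK]. Qed.

Lemma stabM u v : stab u -> stab v -> stab (u \o v)%VF.
Proof. by move=> [uW uc] [vW vc]; split; [exact: weylM|rewrite comp_lfunE vc]. Qed.

(** For the first letter, the positive root [α i \o word_prod s] takes the value $-\alpha_i(c)$ at
    $c$; dominance forces $\alpha_i(c)=0$, so the rest of the word fixes $c$ as well. *)
Lemma stab_word s : len (word_prod s) = size s -> word_prod s c = c ->
  {in s, forall i, α i c = 0}.
Proof.
elim: s => [|i s IH] //= ls sc; have sW := weyl_word s.
have ls' : len (word_prod s) = size s.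
  apply/eqP; rewrite eqn_leq len_word -ltnS -ls; exact: len_simple_le.
have pi : posr (α i \o word_prod s)%VF.
  apply/contraT => /(len_desc sW); rewrite ls ls' => /eqP.
  by rewrite -addn2 -{1}(addn0 (size s)) eqn_add2l.
have isP : (α i \o word_prod s)%VF \in Phi by apply: weyl_root (al_root i).
have sc' : word_prod s c = s_ i c by rewrite -{2}sc comp_lfunE sreflK.
have ic : α i c = 0.
  apply/eqP; rewrite eq_le c_dom andbT; have := posr_dom isP pi.
  by rewrite comp_lfunE sc' -comp_lfunE srefl_al opp_lfunE oppr_ge0.
move=> j; rewrite inE => /orP[/eqP->//|]; apply: IH => //.
by rewrite sc' srefl_fix.
Qed.

Lemma stab_pos_eq1 v : stab v ->
  (forall i, α i c = 0 -> posr (α i \o v)%VF) -> v = \1%VF.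
Proof.
move=> [vW vc] pv; apply: (weyl_pos_eq1 vW) => i.
have [/pv //|ic] := eqVneq (α i c) 0.
apply: dom_gt0_posr; first exact: weyl_root (al_root i).
by rewrite comp_lfunE vc lt0r ic c_dom.
Qed.

(** Applied to $w^{-1}$, this says that $w$ keeps the simple roots of $W_c$ positive, which is
    minimality of $w$ in $wW_c$ in terms of roots ([min_repsP]). *)
Let pos_on_stab w := forall i, α i c = 0 -> posr (α i \o w)%VF.

Let pos_on_stab_root w b : weyl w -> pos_on_stab w -> b \in Phi -> b c = 0 ->
  posr (b \o w)%VF = posr b.
Proof.
move=> wW pw; suff pos a : a \in Phi -> a c = 0 -> posr a -> posr (a \o w)%VF.
  move=> bP bc; apply/idP/idP => [|/pos//]; last exact.
  apply: contraTT; rewrite -!posrN //; last exact: weyl_root.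
  rewrite -comp_lfunNl; apply: pos; first exact: rootN.
  by rewrite opp_lfunE bc oppr0.
move=> aP ac pa; apply: posr_comp => // i ai.
by apply: pw; apply: dom_support ai.
Qed.

Let pos_on_stab_unique v w : stab v -> weyl w -> pos_on_stab w ->
  pos_on_stab (v \o w)%VF -> v = \1%VF.
Proof.
move=> vS wW pw pvw; apply: (stab_pos_eq1 vS) => i ic.
have [vW vc] := vS.
rewrite -(pos_on_stab_root wW pw); last by rewrite comp_lfunE vc.
  by rewrite -comp_lfunA; exact: pvw.
exact: weyl_root (al_root i).
Qed.

Let min_reps_pos w : Wc w -> pos_on_stab w^-1%VF.
Proof.
move=> [wW wmin] i ic; apply/contraT => ni.
have := wmin _ (stab_simple ic); rewrite -(lenV wW) (len_desc (weylV wW) ni).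
rewrite -(lenV (weylM wW (weyl_simple i))) weylMV ?simpleV ?ltnn //.
exact: weyl_simple.
Qed.

Lemma min_rep_exists w : weyl w -> exists2 v, Wc v & v c = w c.
Proof.
move=> wW.
have ex : exists n, `[< exists2 v, stab v & len (w \o v)%VF = n >].
  exists (len w); apply/asboolP; exists \1%VF; rewrite ?comp_lfun1r //.
  by split; [exact: weyl1|rewrite id_lfunE].
case: (ex_minnP ex) => n /asboolP[v vS <-] vmin; have [vW vc] := vS.
exists (w \o v)%VF; last by rewrite comp_lfunE vc.
split=> [|u uS]; first exact: weylM.
by apply: vmin; apply/asboolP; exists (v \o u)%VF; rewrite ?comp_lfunA //; exact: stabM.
Qed.

Lemma min_rep_unique v w : Wc v -> Wc w -> v c = w c -> v = w.
Proof.
move=> vWc wWc vwc; have [vW _] := vWc; have [wW _] := wWc.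
suff /(congr1 (fun f => w \o f)%VF) : (w^-1 \o v = \1)%VF.
  by rewrite comp_lfunA weyl_compfV // comp_lfun1l comp_lfun1r.
have vV := weylV vW; have wV := weylV wW.
apply: (pos_on_stab_unique _ vV (min_reps_pos vWc)).
  by split; [exact: weylM|rewrite comp_lfunE vwc weylK].
by rewrite -comp_lfunA weyl_compfV // comp_lfun1r; exact: min_reps_pos.
Qed.

(** For the converse, the coset contains a minimal element, which also has the positivity property,
    and that property singles out one element of the coset. *)
Lemma min_repsP w : weyl w ->
  Wc w <-> forall i, α i c = 0 -> posr (α i \o w^-1)%VF.
Proof.
move=> wW; split=> [|pw]; first exact: min_reps_pos.
have [v vWc vwc] := min_rep_exists wW; have [vW _] := vWc.
suff /(congr1 (fun f => v \o f)%VF) : (v^-1 \o w = \1)%VF.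
  by rewrite comp_lfunA weyl_compfV // comp_lfun1l comp_lfun1r => ->.
have vV := weylV vW; have wV := weylV wW.
apply: (pos_on_stab_unique _ wV pw).
  by split; [exact: weylM|rewrite comp_lfunE -vwc weylK].
by rewrite -comp_lfunA weyl_compfV // comp_lfun1r; exact: min_reps_pos.
Qed.

Lemma min_reps_root w b : Wc w -> b \in Phi -> b c = 0 ->
  posr (b \o w^-1)%VF = posr b.
Proof.
by move=> wWc; apply: pos_on_stab_root (min_reps_pos wWc); apply/weylV; case: wWc.
Qed.

(** Left multiplication by $s_j$ could only spoil positivity at an $i$ with $w\alpha_i=\alpha_j$,
    and then $\alpha_j(wc)=\alpha_i(c)=0$. *)
Lemma min_reps_simple w j : Wc w -> α j (w c) != 0 -> Wc (s_ j \o w)%VF.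
Proof.
move=> wWc jw; have [wW _] := wWc; have sW := weyl_simple j.
apply/min_repsP => [|i ic]; first exact: weylM.
rewrite weylMV // simpleV comp_lfunA.
apply: posr_comp_simple; first exact/weyl_root/al_root/weylV.
  exact: min_reps_pos.
apply: contra_neq jw => iw.
by rewrite -iw comp_lfunE weylK.
Qed.

(** The root $w^{-1}\alpha_j$ is positive and vanishes at $c$, so it is a sum of simple roots of
    $W_c$. These stay positive under $w$ and add up to the simple root $\alpha_j$, so there is only
    one of them. *)
Lemma min_reps_fix w j : Wc w -> α j (w c) = 0 ->
  exists2 i, α i c = 0 & (α j \o w)%VF = α i.
Proof.
move=> wWc jw; have [wW _] := wWc; have wV := weylV wW.
have bP : (α j \o w)%VF \in Phi by apply: weyl_root (al_root j).
have bc : (α j \o w)%VF c = 0 by rewrite comp_lfunE.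
have bE : ((α j \o w) \o w^-1)%VF = α j.
  by rewrite -comp_lfunA weyl_compfV // comp_lfun1r.
have pb : posr (α j \o w)%VF by rewrite -(min_reps_root wWc bP bc) bE posr_al.
have [|i iE] := posr_comp_eq_simple wV bP pb _ bE.
  by move=> i /(dom_support bP pb bc); exact: min_reps_pos.
by exists i => //; rewrite -iE.
Qed.

Lemma srefl_weyl_comp w i j : weyl w -> (α j \o w)%VF = α i ->
  (s_ j \o w)%VF = (w \o s_ i)%VF.
Proof.
move=> wW jwi; rewrite -[s_ i]/(refl (α i)) -jwi refl_weyl_comp //.
by rewrite !comp_lfunA weyl_compfV // comp_lfun1l.
Qed.

End Dominant.

Section LongestElement.
Variable w0 : 'End(E).
Hypothesis w0_longest : is_longest dot al Phi w0.

Let w0W : weyl w0. Proof. by case: w0_longest. Qed.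

Lemma longest_simple i : ~~ posr (α i \o w0)%VF.
Proof.
apply/negP => /(len_asc w0W) l; have [_] := w0_longest.
by move=> /(_ _ (weylM (weyl_simple i) w0W)); rewrite l ltnn.
Qed.

Lemma longest_root b : b \in Phi -> posr (b \o w0)%VF = ~~ posr b.
Proof.
suff neg a : a \in Phi -> posr a -> ~~ posr (a \o w0)%VF.
  move=> bP; have [/neg -/(_ bP)/negPf//|nb] := boolP (posr b).
  have := neg _ (rootN bP); rewrite posrN // nb comp_lfunNl posrN ?negbK //.
    by apply.
  exact: weyl_root.
move=> aP pa; have aw : (a \o w0)%VF \in Phi by apply: weyl_root.
rewrite -posrN //; have [n aE] := posr_comb aP pa; apply/forallP => j.
rewrite aE comp_suml linearN linear_sum /= -sumrN; apply: sumr_ge0 => i _.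
rewrite raddfMn /= -mulNrn; apply: mulrn_wge0; rewrite -linearN.
have iw : (α i \o w0)%VF \in Phi by apply: weyl_root (al_root i).
by move: (longest_simple i); rewrite -posrN // => /forallP h; exact: h.
Qed.

Lemma longest_compK : (w0 \o w0)%VF = \1%VF.
Proof.
apply: weyl_pos_eq1; first exact: weylM.
move=> i; rewrite comp_lfunA longest_root; first exact: longest_simple.
exact: weyl_root (al_root i).
Qed.

Lemma longestK : involutive w0.
Proof. by move=> x; rewrite -comp_lfunE longest_compK id_lfunE. Qed.

Lemma longestV : w0^-1%VF = w0.
Proof. by apply: weyl_inv_eq longest_compK. Qed.

(** Applying $-w_0$ to the expansion of the positive root $-w_0\alpha_j$ writes $\alpha_j$ as a sum
    of positive roots $-w_0\alpha_i$, and simple roots are indecomposable. *)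
Lemma longest_star j : exists i, (α j \o w0)%VF = - α i.
Proof.
have jP : - (α j \o w0)%VF \in Phi by apply/rootN/weyl_root/al_root.
have pj : posr (- (α j \o w0)%VF).
  by rewrite posrN ?longest_simple //; apply: weyl_root (al_root j).
have [n nE] := posr_comb jP pj.
have [i _||i _ ij] := @simple_indecomposable n (fun i => - (α i \o w0)%VF) j.
- split; first exact/rootN/weyl_root/al_root.
  by rewrite posrN ?longest_simple //; apply: weyl_root (al_root i).
- rewrite (eq_bigr (fun i => - ((α i \o w0)%VF *+ n i))) => [|i _]; last first.
    by rewrite mulNrn.
  rewrite sumrN -comp_suml -nE comp_lfunNl opprK -comp_lfunA longest_compK.
  by rewrite comp_lfun1r.
exists i; rewrite -ij comp_lfunNl -comp_lfunA longest_compK comp_lfun1r.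
by [].
Qed.

(** The involution $j\mapsto j'$ of the Dynkin diagram induced by $-w_0$; by [longest_star] the
    default value is never taken. *)
Definition star j := odflt j [pick i | (α j \o w0)%VF == - α i].

Lemma starP j : (α j \o w0)%VF = - α (star j).
Proof.
rewrite /star; case: pickP => [i /eqP //|h].
by have [i /eqP] := longest_star j; rewrite h.
Qed.

Lemma starE i y : α (star i) (w0 y) = - α i y.
Proof.
have /(congr1 (fun f : 'Hom(E, R^o) => f (w0 y))) := starP i.
by rewrite opp_lfunE comp_lfunE longestK => ->; rewrite opprK.
Qed.

Lemma al_inj : injective α.
Proof.
move=> i j ij; have := coord_al i i; rewrite {1}ij coord_al eqxx.
by case: eqVneq => // _ /esym/eqP; rewrite oner_eq0.
Qed.

Lemma starK : involutive star.
Proof.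
move=> j; apply: al_inj; apply: oppr_inj; rewrite -starP.
by apply/lfunP => y; rewrite comp_lfunE starE opp_lfunE.
Qed.

Lemma longest_coroot j : w0 (coroot (α j)) = - coroot (α (star j)).
Proof.
by rewrite -corootN -starP coroot_weyl_comp // longestV.
Qed.

Lemma longest_srefl j : (w0 \o s_ j = s_ (star j) \o w0)%VF.
Proof.
rewrite -[s_ j]/(refl (α j)) -[s_ (star j)]/(refl (α (star j))).
have -> : refl (α (star j)) = refl (α j \o w0)%VF by rewrite starP reflN.
by rewrite refl_weyl_comp // longestV -!comp_lfunA longest_compK comp_lfun1r.
Qed.

Section MinimalDecomposition.
Variables (c : E) (w0c v0 : 'End(E)).
Hypothesis c_dom : forall i, 0 <= α i c.
Hypothesis w0cP : min_reps dot al Phi c w0c.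
Hypothesis v0P : stab dot Phi c v0.
Hypothesis w0E : w0 = (w0c \o v0)%VF.

Let v0W : weyl v0. Proof. by case: v0P. Qed.
Let w0cW : weyl w0c. Proof. by case: w0cP. Qed.

(** On roots that vanish at $c$ the factor $w_0^c$ preserves signs, so the sign change of $w_0$ is
    due to $w_{0,c}$: it is the longest element of $W_c$. *)
Let posr_v0V b : b \in Phi -> b c = 0 -> posr (b \o v0^-1)%VF = ~~ posr b.
Proof.
move=> bP bc; have [v0'W v0'c] := stabV v0P.
rewrite -(min_reps_root c_dom w0cP); last by rewrite comp_lfunE v0'c.
  by rewrite -comp_lfunA -weylMV // -w0E longestV longest_root.
exact: weyl_root.
Qed.

Lemma longest_stabV : v0^-1%VF = v0.
Proof.
have v0'P := stabV v0P; have [v0'W v0'c] := v0'P.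
rewrite -[RHS]weylVV //; apply/esym/weyl_inv_eq => //.
apply: (stab_pos_eq1 c_dom); first exact: stabM.
move=> i ic; have iP := al_root i; rewrite comp_lfunA !posr_v0V ?negbK ?posr_al //.
  exact: weyl_root.
by rewrite comp_lfunE v0'c.
Qed.

Lemma posr_longest_stab b : b \in Phi -> b c = 0 ->
  posr (b \o v0)%VF = ~~ posr b.
Proof. by move=> bP bc; rewrite -{1}longest_stabV posr_v0V. Qed.

Lemma longest_compl : (w0 \o w0c)%VF = v0.
Proof.
rewrite -{1}longestV w0E weylMV // -comp_lfunA weyl_compV // comp_lfun1r.
exact: longest_stabV.
Qed.

Lemma longest_comp_fix i : α (star i) (w0c c) = 0 <-> α i c = 0.
Proof.
have [_ v0c] := v0P.
have -> : w0c c = w0 c by rewrite w0E comp_lfunE v0c.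
by rewrite starE; split=> [/eqP|->]; rewrite ?oppr0 // oppr_eq0 => /eqP.
Qed.

(** It suffices that $ww_{0,c}$ makes every simple root negative, as only $w_0$ does. If
    $\alpha_j(wc)<0$ this follows from dominance of $c$; if $\alpha_j(wc)=0$, then $w^{-1}\alpha_j$
    is a simple root of $W_c$ and $w_{0,c}$ makes it negative. *)
Lemma min_reps_max w : min_reps dot al Phi c w ->
  (forall j, α j (w c) <= 0) -> w = w0c.
Proof.
move=> wWc wle; have [wW _] := wWc; have [_ v0c] := v0P.
suff wv : (w \o v0 = w0)%VF.
  move/(congr1 (fun f => f \o v0^-1)%VF): wv.
  by rewrite w0E -!comp_lfunA weyl_compfV // !comp_lfun1r.
rewrite -[RHS]longestV; apply/esym/weyl_inv_eq => //.
have wvW := weylM wW v0W; apply: (weyl_pos_eq1 (weylM wvW w0W)) => j.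
have jP : (α j \o w)%VF \in Phi by apply: weyl_root (al_root j).
have jvP : ((α j \o w) \o v0)%VF \in Phi by apply: weyl_root jP.
rewrite !comp_lfunA longest_root //.
have [jw|jw] := eqVneq (α j (w c)) 0.
  have [i ic jwi] := min_reps_fix c_dom wWc jw.
  by rewrite posr_longest_stab ?jwi ?posr_al ?al_root.
apply: (dom_lt0_posr c_dom jvP).
by rewrite !comp_lfunE v0c lt_neqAle jw wle.
Qed.

End MinimalDecomposition.
End LongestElement.

(** The length bound given by $w_0$ leaves finitely many reduced words. Finiteness gives the sums
    over $W^c$ their intended meaning. *)
Lemma weyl_finite w0 : is_longest dot al Phi w0 -> finite_set weyl.
Proof.
move=> [w0W w0max]; pose n := (len w0).+1.
pose f (p : {k : 'I_n & k.-tuple 'I_r}) := word_prod (tagged p).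
apply: (@sub_finite_set _ _ (f @` setT)); last exact/finite_image/finite_finset.
move=> w wW; have kn : (len w < n)%N by rewrite ltnS w0max.
exists (Tagged (fun k : 'I_n => k.-tuple 'I_r)
  (in_tuple (red_word w) : (Ordinal kn).-tuple 'I_r)) => //.
exact: red_wordK.
Qed.

(** * Multiplicativity of $T_w$ along products that increase the length *)

Section HeckeElements.
Variables (F : fieldType) (H : unitAlgType F) (T : 'I_r -> H).
Hypothesis T_braid : forall i j m, i != j -> is_order (s_ i \o s_ j)%VF m ->
  altprod m (T i) (T j) = altprod m (T j) (T i).

Local Notation Tw := (Tw dot al T).

Lemma Tw_mull w j : weyl w -> posr (α j \o w)%VF ->
  Tw (s_ j \o w)%VF = T j * Tw w.
Proof.
move=> wW pw; have swW := weylM (weyl_simple j) wW.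
have := matsumoto T_braid (s := red_word (s_ j \o w)%VF) (s' := j :: red_word w).
rewrite big_cons; apply; rewrite ?red_wordK //=; first by rewrite red_wordK.
exact: len_asc.
Qed.

Lemma Tw_mulr w i : weyl w -> posr (α i \o w^-1)%VF ->
  Tw (w \o s_ i)%VF = Tw w * T i.
Proof.
move=> wW pw; have wsW := weylM wW (weyl_simple i).
have := matsumoto T_braid (s := red_word (w \o s_ i)%VF) (s' := rcons (red_word w) i).
rewrite -cats1 big_cat big_seq1; apply; rewrite ?red_wordK //.
  by rewrite word_prod_cat red_wordK //= comp_lfun1r.
rewrite size_cat addn1 -[LHS](lenV wsW) weylMV // ?simpleV; last exact: weyl_simple.
by rewrite len_asc ?lenV //; exact: weylV.
Qed.

End HeckeElements.

(** * The alcove condition on $c$ and the affine orbit of $c$ *)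

Section Alcove.
Variable Lam : set E.
Hypothesis Lam_adm : admissible_lattice dot Phi Lam.

Lemma lattice_zmod : Lam 0 /\ forall x y, Lam x -> Lam y -> Lam (x - y).
Proof.
case: Lam_adm => [[s ->] _ _]; split.
  by exists [ffun=> 0]; rewrite big1 // => i _; rewrite ffunE mulr0z.
move=> _ _ [p ->] [q ->]; exists [ffun i => p i - q i].
by rewrite -sumrB; apply: eq_bigr => i _; rewrite ffunE mulrzBr.
Qed.

Lemma lattice0 : Lam 0. Proof. by case: lattice_zmod. Qed.

Lemma latticeB x y : Lam x -> Lam y -> Lam (x - y).
Proof. by case: lattice_zmod => _; apply. Qed.

Lemma latticeN x : Lam x -> Lam (- x).
Proof. by move=> xL; rewrite -sub0r; apply: latticeB lattice0 xL. Qed.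

Lemma latticeD x y : Lam x -> Lam y -> Lam (x + y).
Proof. by move=> xL yL; rewrite -[y]opprK; apply/latticeB/latticeN. Qed.

Lemma latticeMz x (m : int) : Lam x -> Lam (x *~ m).
Proof.
move=> xL; have nat n : Lam (x *+ n).
  by elim: n => [|n IH]; [exact: lattice0|rewrite mulrS; apply: latticeD].
by case: m => n; [exact: nat|exact/latticeN/nat].
Qed.

Lemma lattice_coroot b : b \in Phi -> Lam (coroot b).
Proof.
move=> bP; case: Lam_adm => _ sub _; apply: sub.
set s := [seq coroot a | a <- Phi].
have bs : coroot b \in s by apply: map_f.
have bi : (index (coroot b) s < size s)%N by rewrite index_mem.
exists [ffun i : 'I_(size s) => (i == Ordinal bi)%:Z].
rewrite (bigD1 (Ordinal bi)) //= ffunE eqxx mulr1z nth_index // big1 ?addr0 //.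
by move=> i /negPf ib; rewrite ffunE ib mulr0z.
Qed.

Lemma lattice_int b x : b \in Phi -> Lam x -> b x \is a Num.int.
Proof. by case: Lam_adm => _ _; apply. Qed.

Lemma lattice_srefl i x : Lam x -> s_ i x = x - coroot (α i) *~ Num.floor (α i x).
Proof.
move=> xL; rewrite /srefl reflE -scaler_int floorK //.
exact: lattice_int (al_root i) xL.
Qed.

Lemma lattice_weyl w x : weyl w -> Lam x -> Lam (w x).
Proof.
move=> /weylP[s ->] xL; elim: s => [|i s IH] /=; first by rewrite id_lfunE.
rewrite comp_lfunE lattice_srefl //; apply/latticeB/latticeMz => //.
exact/lattice_coroot/al_root.
Qed.

Variable c : E.
Hypothesis c_C0 : C0 dot al Phi Lam c.

Lemma C0_dom i : 0 <= α i c.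
Proof.
case: c_C0 => /(_ (α i)); rewrite pos_rootP.
by move=> /(_ (conj (al_root i) (posr_al i)))/andP[].
Qed.

(** If $b(c)=1$, the affine reflection $y\mapsto b^\vee+s_b(y)$ would fix $c$ with a nonzero
    translation part. *)
Lemma C0_lt1 b : b \in Phi -> posr b -> b c < 1.
Proof.
move=> bP pb; case: c_C0 => /(_ b); rewrite pos_rootP => /(_ (conj bP pb)).
move=> /andP[_ b1] st; rewrite lt_neqAle b1 andbT; apply/eqP => bc.
have : affine_stab dot Phi Lam c (refl b, coroot b).
  split; rewrite /= ?reflE ?bc ?scale1r; last by rewrite addrC subrK.
    by have [s ->] := refl_word bP; exact: weyl_word.
  exact: lattice_coroot.
by rewrite st => -[_ /= /eqP]; rewrite (negPf (coroot_neq0 _ (root_nz bP))).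
Qed.

Lemma C0_bounds b : b \in Phi -> -1 < b c < 1.
Proof.
move=> bP; have [pb|nb] := boolP (posr b).
  by rewrite C0_lt1 // (lt_le_trans _ (posr_dom C0_dom bP pb)) // oppr_lt0.
have pN : posr (- b) by rewrite posrN.
have := C0_lt1 (rootN bP) pN; have := posr_dom C0_dom (rootN bP) pN.
rewrite opp_lfunE ltrNl oppr_ge0 => /le_lt_trans b1 ->.
exact: b1.
Qed.

Lemma C0_int b : b \in Phi -> (b c \is a Num.int) = (b c == 0).
Proof.
move=> /C0_bounds/andP[lb ub]; apply/idP/idP => [/intrP[m mE]|/eqP->//].
have lm : -1 < m by rewrite -(ltr_int R) -mE.
have um : m < 1 by rewrite -(ltr_int R) -mE.
have m0 : m = 0 by lia.
by rewrite mE m0.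
Qed.

Lemma C0_floor b : b \in Phi -> Num.floor (b c) = if b c < 0 then -1 else 0.
Proof.
move=> /C0_bounds/andP[lb ub]; apply/eqP; rewrite floor_eq.
case: ltP => b0; first by rewrite addNr b0 ltW.
by rewrite add0r b0.
Qed.

Local Notation Wc := (min_reps dot al Phi c).

(** Applying $w^{-1}$ gives an element of the affine stabilizer of $c$ with translation part
    $w^{-1}x$. This is the source of freeness over $F[\Lambda]$. *)
Lemma C0_free v w x : Wc v -> Wc w -> Lam x -> x + v c = w c -> v = w /\ x = 0.
Proof.
move=> vWc wWc xL xE; have [vW _] := vWc; have [wW _] := wWc.
have wV := weylV wW.
have : affine_stab dot Phi Lam c ((w^-1 \o v)%VF, w^-1%VF x).
  split=> /=; [exact: weylM|exact: lattice_weyl|].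
  by rewrite comp_lfunE -linearD /= xE weylK.
case: c_C0 => _ -> [_ /= x0].
have {}x0 : x = 0 by rewrite -[x](weylVK wW) x0 linear0.
by move: xE; rewrite x0 add0r => /(min_rep_unique C0_dom vWc wWc).
Qed.

Lemma orbit_min_rep y : affine_orbit dot Phi Lam c y ->
  exists x w, [/\ Lam x, Wc w & y = x + w c].
Proof.
move=> [x [w [xL wW ->]]]; have [v vWc vw] := min_rep_exists c wW.
by exists x, v; rewrite vw.
Qed.

End Alcove.

(** * Hecke algebra actions *)

Section HeckeGenerators.
Context (F : fieldType) (t : 'Hom(E, R^o) -> F) (Lam : set E).
Context (H : unitAlgType F) (T : 'I_r -> H) (X : E -> H).
Hypothesis t_inv : invariant_parameter dot Phi t.
Hypothesis HT : hecke_relations dot al Lam t T X.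

Local Notation q_ := (tpar al t).
Local Notation τ_ j := (q_ j - (q_ j)^-1).

Lemma tpar_neq0 j : q_ j != 0.
Proof. by case: t_inv => t0 _; apply: t0; exact: al_root. Qed.

Lemma tpar_conj w i j : weyl w -> (α j \o w)%VF = α i -> q_ i = q_ j.
Proof.
case: t_inv => _ tw wW ji; apply/esym.
by apply: (tw w); rewrite ?ji //; exact: al_root.
Qed.

Lemma hecke_mulV j : T j * (T j - (τ_ j)%:A) = 1.
Proof.
have := hecke_quad HT j; have := tpar_neq0 j; set q := q_ j => q0.
rewrite mulrDr !mulrBl -!scalerAl -!scalerAr !mul1r !mulr1 scalerA divff // scale1r.
move=> /eqP; rewrite addrA subr_eq0 => /eqP e.
by rewrite mulrBr mulr_algr -[RHS]e scalerBl opprB addrA addrAC.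
Qed.

Lemma hecke_Vmul j : (T j - (τ_ j)%:A) * T j = 1.
Proof. by rewrite mulrBl mulr_algl -(mulr_algr _ (T j)) -mulrBr hecke_mulV. Qed.

Lemma hecke_unit j : T j \is a GRing.unit.
Proof.
by apply/unitrP; exists (T j - (τ_ j)%:A); rewrite hecke_mulV hecke_Vmul.
Qed.

Lemma hecke_inv j : (T j)^-1 = T j - (τ_ j)%:A.
Proof. by apply: (mulrI (hecke_unit j)); rewrite divrr ?hecke_unit // hecke_mulV. Qed.

Lemma Tw_unit w : Tw dot al T w \is a GRing.unit.
Proof. by apply: unitr_prod => i _; exact: hecke_unit. Qed.

Variable eps : int.
Hypothesis epsE : eps = 1 \/ eps = - 1.

Definition twist_gen (j : 'I_r) : H := if eps == 1 then (T j)^-1 else - T j.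

(** The product $V_{j_1}\cdots V_{j_k}$ along a reduced word of [u]; for $\epsilon=1$ the inverse
    inside [Tw] undoes the reversal of factors caused by the outer inverse. *)
Definition twist_elt (u : 'End(E)) : H :=
  if eps == 1 then (Tw dot al T u^-1%VF)^-1
  else (-1) ^+ len u *: Tw dot al T u.

Definition eps_eigen (j : 'I_r) : F := eps%:~R * q_ j ^ eps.

Lemma eps_eigenE j : eps_eigen j = if eps == 1 then q_ j else - (q_ j)^-1.
Proof.
rewrite /eps_eigen; case: epsE => -> /=; first by rewrite mul1r expr1z.
by rewrite mulN1r -exprN1.
Qed.

Lemma twist_mull u j : weyl u -> posr (α j \o u)%VF ->
  twist_elt (s_ j \o u)%VF = twist_gen j * twist_elt u.
Proof.
move=> uW pu; rewrite /twist_elt /twist_gen; have sW := weyl_simple  j.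
case: eqP => _; last first.
  rewrite (len_asc  uW pu) Tw_mull //.
    by rewrite exprS mulN1r scaleNr mulNr scalerAr.
  exact: hecke_braid HT.
rewrite (weylMV  sW uW) simpleV.
rewrite Tw_mulr ?invrM ?Tw_unit ?hecke_unit //.
- exact: hecke_braid HT.
- exact: weylV.
- by rewrite weylVV.
Qed.

Lemma twist_mulr u i : weyl u -> posr (α i \o u^-1)%VF ->
  twist_elt (u \o s_ i)%VF = twist_elt u * twist_gen i.
Proof.
move=> uW pu; rewrite /twist_elt /twist_gen; have sW := weyl_simple  i.
have uV := weylV  uW.
have e : ((u \o s_ i)^-1 = s_ i \o u^-1)%VF.
  by rewrite (weylMV  uW sW) simpleV.
case: eqP => _; last first.
  rewrite -(lenV  (weylM  uW sW)) e.
  rewrite (len_asc  uV pu) (lenV  uW).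
  rewrite Tw_mulr //.
    by rewrite exprS mulN1r scaleNr mulrN -scalerAl.
  exact: hecke_braid HT.
rewrite e Tw_mull ?invrM ?Tw_unit ?hecke_unit //.
exact: hecke_braid HT.
Qed.

End HeckeGenerators.

Section PolynomialAction.
Context (F : fieldType) (t : 'Hom(E, R^o) -> F) (Lam : set E).
Context (H : unitAlgType F) (T : 'I_r -> H) (X : E -> H).
Context (pi : H -> {malg F[E]} -> {malg F[E]}) (eps : int) (w0 : 'End(E)).
Hypothesis t_inv : invariant_parameter dot Phi t.
Hypothesis HT : hecke_relations dot al Lam t T X.
Hypothesis Lam_adm : admissible_lattice dot Phi Lam.
Hypothesis piP : is_polynomial_rep dot al Lam t T X pi.
Hypothesis epsE : eps = 1 \/ eps = - 1.
Hypothesis w0_longest : is_longest dot al Phi w0.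

Implicit Types f g p : {malg F[E]}.

Local Notation q_ := (tpar al t).
Local Notation τ_ j := (q_ j - (q_ j)^-1).
Local Notation nab := (nabla dot al).
Local Notation V_ := (twist_gen T eps).
Local Notation e_ := (eps_eigen t eps).

Let L0 : Lam 0. Proof. exact: lattice0. Qed.

Let LB y z : Lam y -> Lam z -> Lam (y - z). Proof. exact: latticeB. Qed.

Let Lco j : Lam (coroot (α j)).
Proof. exact: (lattice_coroot Lam_adm (al_root j)). Qed.

Let sco j : s_ j (coroot (α j)) = - coroot (α j).
Proof. exact: refl_coroot (al_nz  j). Qed.

Let sL j y : Lam y -> exists m : int, s_ j y = y - coroot (α j) *~ m.
Proof.
by move=> yL; exists (Num.floor (α j y)); rewrite (lattice_srefl Lam_adm).
Qed.

Lemma nabla_span j f : gaspan Lam f -> gaspan Lam (nab j f).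
Proof.
by move=> fL; exact (divdiff_span L0 LB (Lco j) (sL j) (corootMn_neq0 j) fL).
Qed.

Lemma nablaP_lin j k f g : gaspan Lam f -> gaspan Lam g ->
  nab j (k *: f + g) = k *: nab j f + nab j g.
Proof.
exact (divdiffP_lin L0 LB (Lco j) (sL j) (corootMn_neq0 j) k (f := f) (g := g)).
Qed.

Lemma srefl_span j (f : {malg F[E]}) : gaspan Lam f -> gaspan Lam (gamap (s_ j) f).
Proof. exact (gaspan_s L0 LB (Lco j) (sL j) (f := f)). Qed.

(* Conjugation by [twist_map] turns the coefficient equations of an
   eps-symmetric quasi-polynomial into the action of the [twist_gen]. *)
Definition twist_map : 'End(E) := if eps == 1 then w0 else - w0.

Local Notation M := (gamap twist_map).

Let w0K : involutive w0 := longestK w0_longest.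

Lemma twist_mapK : involutive twist_map.
Proof.
rewrite /twist_map => y; case: eqP => _; first exact: w0K.
by rewrite !opp_lfunE linearN /= opprK w0K.
Qed.

Lemma twist_mapL y : Lam y -> Lam (twist_map y).
Proof.
have w0W : weyl w0 by case: w0_longest.
move=> yL; rewrite /twist_map; case: eqP => _; first exact: lattice_weyl.
by rewrite opp_lfunE; apply: latticeN => //; exact: lattice_weyl.
Qed.

Lemma gamap_twist_span (f : {malg F[E]}) : gaspan Lam f -> gaspan Lam (M f).
Proof. exact: gaspan_map twist_mapL. Qed.

Lemma gamap_twistK : involutive (@gamap F E twist_map).
Proof. exact: gamap_sK twist_mapK. Qed.

Local Notation star := (star w0).

Lemma tpar_star j : q_ (star j) = q_ j.
Proof.
have w0W : weyl w0 by case: w0_longest.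
(* The element $w_0$ alone links $\alpha_j$ to $-\alpha_{j'}$; the extra $s_{j'}$ corrects the
   sign. *)
apply: (tpar_conj t_inv (w := (w0 \o s_ (star j))%VF)).
  by apply: weylM => //; exact: weyl_simple.
rewrite comp_lfunA (starP w0_longest) comp_lfunNl.
by rewrite srefl_al opprK.
Qed.

Let twist_srefl j y : twist_map (s_ j y) = s_ (star j) (twist_map y).
Proof.
have /lfunP/(_ y) := longest_srefl w0_longest j.
rewrite !comp_lfunE /twist_map => e; case: eqP => _ //.
by rewrite !opp_lfunE e linearN.
Qed.

Let twist_coroot j : twist_map (coroot (α j)) =
  if eps == 1 then - coroot (α (star j)) else coroot (α (star j)).
Proof.
rewrite /twist_map; have := longest_coroot w0_longest j.
by case: eqP => _ e; rewrite ?opp_lfunE e ?opprK.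
Qed.

Lemma pi_T j f : gaspan Lam f ->
  pi (T j) f = q_ j *: gamap (s_ j) f + τ_ j *: nab j f.
Proof. by move=> fL; rewrite (pol_T piP). Qed.

Lemma pi_span h f : gaspan Lam f -> gaspan Lam (pi h f).
Proof. exact: rep_stable (pol_rep piP) h f. Qed.

Lemma pi_Tinv j f : gaspan Lam f -> pi (T j)^-1 f = pi (T j) f - τ_ j *: f.
Proof.
move=> fL; rewrite (hecke_inv t_inv HT) (repB (pol_rep piP)) //.
by rewrite (rep_scalar (pol_rep piP)).
Qed.

Lemma pi_TinvK j f : gaspan Lam f -> pi (T j)^-1 (pi (T j) f) = f.
Proof.
move=> fL; rewrite -(repM (pol_rep piP)) // mulVr ?(rep1 (pol_rep piP)) //.
exact: (hecke_unit t_inv HT).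
Qed.

Lemma pi_TKinv j f : gaspan Lam f -> pi (T j) (pi (T j)^-1 f) = f.
Proof.
move=> fL; rewrite -(repM (pol_rep piP)) // mulrV ?(rep1 (pol_rep piP)) //.
exact: (hecke_unit t_inv HT).
Qed.

(** For both signs $V_j$ is affine in $T_j$, as $T_j^{-1}=T_j-(t_j-t_j^{-1})$, so one eigenvalue
    equation is the other rewritten. *)
Lemma twist_eigen_iff j p : gaspan Lam p ->
  pi (T j) p = e_ j *: p <-> pi (V_ j) p = (q_ j)^-1 *: p.
Proof.
move=> pL; rewrite eps_eigenE // /twist_gen; case: eqP => _; last first.
  rewrite (repN (pol_rep piP)) // scaleNr.
  by split=> [->|<-]; rewrite opprK.
rewrite pi_Tinv //; split=> [->|].
  by rewrite -scalerBl opprB addrC subrK.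
by move=> /(canRL (subrK _)) ->; rewrite -scalerDl addrC subrK.
Qed.

Lemma twist_zero_iff j g : gaspan Lam g ->
  q_ j *: gamap (s_ j) g + τ_ j *: nab j g = e_ j *: g <->
  pi (V_ (star j)) (M g) = (q_ j)^-1 *: M g.
Proof.
move=> gL; have MgL := gamap_twist_span gL.
rewrite eps_eigenE // /twist_gen; have := twist_coroot j.
case: eqP => _ co.
  rewrite pi_Tinv // pi_T // tpar_star.
  exact: (sym_zero_iff L0 LB (Lco j) (sL j) (corootMn_neq0 j) (Lco _) (sL _) (corootMn_neq0 _)
    twist_mapL twist_mapK (twist_srefl j) (tpar_neq0 t_inv j) co gL).
rewrite (repN (pol_rep piP)) // pi_T // tpar_star.
rewrite (anti_zero_iff L0 LB (Lco j) (sL j) (corootMn_neq0 j) (corootMn_neq0 (star j))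
  twist_mapK (twist_srefl j) (q_ j) co gL).
by rewrite scaleNr; split=> [->|<-]; rewrite opprK.
Qed.

Lemma twist_neg_iff j g g' : gaspan Lam g ->
  gamap (s_ j) g' + τ_ j *: (gamap (s_ j) g + nab j g) = e_ j *: g <->
  M g' = pi (V_ (star j)) (M g).
Proof.
move=> gL; have MgL := gamap_twist_span gL.
rewrite eps_eigenE // /twist_gen; have := twist_coroot j.
case: eqP => _ co.
  rewrite pi_Tinv // pi_T // tpar_star.
  exact: (sym_neg_iff L0 LB (Lco j) (sreflK j) (sco j) (sL j) (corootMn_neq0 j) (Lco _)
    (sreflK _) (sco _) (sL _) (corootMn_neq0 _) twist_mapL twist_mapK (twist_srefl j)
    (q_ j) g' co gL).
rewrite (repN (pol_rep piP)) // pi_T // tpar_star.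
exact: (anti_neg_iff L0 LB (Lco j) (sreflK j) (sL j) (corootMn_neq0 j) (Lco _)
  (sreflK _) (sco _) (sL _) (corootMn_neq0 _) twist_mapL twist_mapK (twist_srefl j)
  (q_ j) g' co gL).
Qed.

(** Transport gives $Mg'=V_{j'}^{-1}Mg$ for both signs; it is inverted here so that the positive and
    negative cases both speak of $V_{j'}$ only. *)
Lemma twist_pos_iff j g g' : gaspan Lam g -> gaspan Lam g' ->
  gamap (s_ j) g' + τ_ j *: nab j g = e_ j *: g <->
  M g = pi (V_ (star j)) (M g').
Proof.
move=> gL g'L; have MgL := gamap_twist_span gL; have Mg'L := gamap_twist_span g'L.
rewrite eps_eigenE // /twist_gen; have := twist_coroot j.
case: eqP => _ co.
  have e : gamap (s_ j) g' + τ_ j *: nab j g = q_ j *: g <->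
      M g' = pi (T (star j)) (M g).
    rewrite pi_T // tpar_star.
    exact: (sym_pos_iff L0 LB (Lco j) (sreflK j) (sco j) (sL j) (corootMn_neq0 j) (Lco _)
      (sreflK _) (sco _) (sL _) (corootMn_neq0 _) twist_mapL twist_mapK (twist_srefl j)
      (q_ j) g' co gL).
  by rewrite e; split=> ->; rewrite ?pi_TinvK ?pi_TKinv.
have e : gamap (s_ j) g' + τ_ j *: nab j g = - (q_ j)^-1 *: g <->
    M g' = - pi (T (star j))^-1 (M g).
  rewrite pi_Tinv // pi_T // tpar_star.
  exact: (anti_pos_iff L0 LB (Lco j) (sreflK j) (sL j) (corootMn_neq0 j) (Lco _)
    (sreflK _) (sco _) (sL _) (corootMn_neq0 _) twist_mapL twist_mapK (twist_srefl j)
    (q_ j) g' co gL).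
have L0' : gaspan Lam (0 : {malg F[E]}) := @gaspan0 F E Lam.
have TL := pi_span (h := T (star j)) Mg'L.
have VL := pi_span (h := (T (star j))^-1) MgL.
have r1 : pi (T (star j)) (- pi (T (star j))^-1 (M g)) = - M g.
  by rewrite (rep_vN (pol_rep piP) _ L0' VL); congr (- _); exact: (pi_TKinv _ MgL).
have r2 : pi (T (star j))^-1 (- pi (T (star j)) (M g')) = - M g'.
  by rewrite (rep_vN (pol_rep piP) _ L0' TL); congr (- _); exact: (pi_TinvK _ Mg'L).
rewrite e (repN (pol_rep piP) _ Mg'L).
by split=> h; rewrite [in RHS]h ?r1 ?r2 opprK.
Qed.

End PolynomialAction.

(** * Quasi-polynomials *)

Section QuasiPolynomials.
Variables (F : fieldType) (Lam : set E) (c : E) (w0 : 'End(E)).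
Hypothesis Lam_adm : admissible_lattice dot Phi Lam.
Hypothesis c_C0 : C0 dot al Phi Lam c.
Hypothesis w0_longest : is_longest dot al Phi w0.
Implicit Types (f p : {malg F[E]}) (g : 'End(E) -> {malg F[E]}).

Local Notation Wc := (min_reps dot al Phi c).
Local Notation Ws := (fset_set Wc).

Let c_dom i : 0 <= α i c. Proof. exact: C0_dom c_C0 i. Qed.

Lemma min_reps_finite : finite_set Wc.
Proof. by apply: sub_finite_set (weyl_finite w0_longest) => w []. Qed.

Lemma mem_Ws w : w \in Ws <-> Wc w.
Proof. by rewrite (in_fset_set min_reps_finite) inE. Qed.

Definition span_family g := forall w, Wc w -> gaspan Lam (g w).

Definition quasi g : {malg F[E]} := \sum_(w \in Wc) gamul (g w) << w c >>.

Lemma quasiE g : quasi g = \sum_(w <- Ws) gamul (g w) << w c >>.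
Proof. exact/fsbig_finite/min_reps_finite. Qed.

Lemma eq_quasi g g' : (forall w, Wc w -> g w = g' w) -> quasi g = quasi g'.
Proof.
by move=> gg'; rewrite !quasiE; apply: eq_big_seq => w /mem_Ws /gg' ->.
Qed.

Lemma quasi_linear k g g' :
  quasi (fun w => k *: g w + g' w) = k *: quasi g + quasi g'.
Proof.
rewrite !quasiE scaler_sumr -big_split; apply: eq_bigr => w _ /=.
by rewrite gamul_linl.
Qed.

Lemma quasi_span g : span_family g ->
  gaspan (affine_orbit dot Phi Lam c) (quasi g).
Proof.
move=> gL; rewrite quasiE; apply: gaspan_sum => w /mem_Ws wWc.
apply: gaspan_mulU (gL w wWc) => y yL.
by exists y, w; split=> //; case: wWc.
Qed.

(** By [C0_free] the cosets $\Lambda+wc$ for distinct $w\in W^c$ are disjoint, so only one summand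
    contributes. *)
Lemma quasi_coeff g w y : span_family g -> Wc w -> Lam y ->
  (quasi g)@_(y + w c) = (g w)@_y.
Proof.
move=> gL wWc yL; rewrite quasiE raddf_sum /=.
have wWs : w \in Ws by apply/mem_Ws.
rewrite (big_fsetD1 w) //= mcoeff_gamulU addrK big1_seq ?addr0 // => v /andP[_].
rewrite in_fsetD1 => /andP[vw /mem_Ws vWc]; rewrite mcoeff_gamulU.
apply/eqP/contraT => gv.
have zL : Lam (y + w c - v c) by move/gaspanP: (gL v vWc) => h; exact: h gv.
have [||vwE _] := @C0_free _ Lam_adm c c_C0 v w (y + w c - v c - y) vWc wWc.
- exact: latticeB.
- by rewrite addrAC subrK addrAC subrr add0r.
by rewrite vwE eqxx in vw.
Qed.

Lemma quasi_inj g g' : span_family g -> span_family g' -> quasi g = quasi g' ->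
  forall w, Wc w -> g w = g' w.
Proof.
move=> gL g'L gg' w wWc; apply/malgP => y.
have [yL|yL] := pselect (Lam y); last first.
  by rewrite !mcoeff_outdom //; apply/negP; [move=> /(g'L w wWc)|move=> /(gL w wWc)].
by rewrite -(quasi_coeff gL wWc yL) gg' (quasi_coeff g'L wWc yL).
Qed.

Lemma quasi_exists f : gaspan (affine_orbit dot Phi Lam c) f ->
  exists2 g, span_family g & f = quasi g.
Proof.
move: f; apply: gaspan_ind => [|k f f' _ _ [g gL ->] [g' g'L ->]|y yO].
- exists (fun _ => 0); first by move=> w _; exact: gaspan0.
  by rewrite quasiE big1 // => w _; rewrite linear0l.
- exists (fun w => k *: g w + g' w); last by rewrite quasi_linear.
  by move=> w wWc; apply: gaspanP_lin; [exact: gL|exact: g'L].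
have [x [w [xL wWc ->]]] := orbit_min_rep yO.
exists (fun v => if v == w then << x >> else 0).
  by move=> v _; case: eqP => _; [exact: gaspanU|exact: gaspan0].
have wWs : w \in Ws by apply/mem_Ws.
rewrite quasiE (big_fsetD1 w) //= eqxx gamulUU big1_seq ?addr0 // => v /andP[_].
by rewrite in_fsetD1 => /andP[/negPf-> _]; rewrite linear0l.
Qed.

Lemma gamma_qpP f : gaspan (affine_orbit dot Phi Lam c) f ->
  span_family (gamma_qp dot Phi al Lam c f) /\
  f = quasi (gamma_qp dot Phi al Lam c f).
Proof.
move=> /quasi_exists[g gL fE].
exact: (@xgetPex _ (fun=> 0) [set g | span_family g /\ f = quasi g]
  (ex_intro _ g (conj gL fE))).
Qed.

Lemma gamma_qp_quasi g w : span_family g -> Wc w ->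
  gamma_qp dot Phi al Lam c (quasi g) w = g w.
Proof.
move=> gL; have [gL' gE] := gamma_qpP (quasi_span gL).
by apply: quasi_inj.
Qed.

Variables (t : 'Hom(E, R^o) -> F) (H : unitAlgType F) (T : 'I_r -> H) (X : E -> H).
Variables (piqp : H -> {malg F[E]} -> {malg F[E]}).
Hypothesis HT : hecke_relations dot al Lam t T X.
Hypothesis piqpP : is_quasi_polynomial_rep dot al Lam t T X piqp.

Local Notation q_ := (tpar al t).
Local Notation τ_ j := (q_ j - (q_ j)^-1).
Local Notation nab := (nabla dot al).

Let qpT (v : {malg F[E]}) : setT v. Proof. by []. Qed.

Lemma piqp_X l f : Lam l -> piqp (X l) f = gamul << l >> f.
Proof.
move=> lL; elim/ga_ind: f => [|k f f' IHf IHf'|y].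
- by rewrite (rep_v0 (qp_rep piqpP)) // gamul0r.
- by rewrite (rep_linear (qp_rep piqpP)) // gamul_linr IHf IHf'.
by rewrite (qp_X piqpP) // gamulUU.
Qed.

Lemma piqp_gaeval p f : gaspan Lam p -> piqp (gaeval X p) f = gamul p f.
Proof.
move=> pL; move: p pL.
apply: gaspan_ind => [|k p p' _ _ IHp IHp'|l lL].
- by rewrite raddf0 (rep0 (qp_rep piqpP)) // gamul0l.
- by rewrite gamul_linl -IHp -IHp' linearP (rep_linearl (qp_rep piqpP)).
by rewrite gaevalU piqp_X.
Qed.

(** The cross relation of the Hecke algebra, extended linearly from $x^\lambda$ to $p$ and read in
    the representation. *)
Lemma piqp_T_mul j p f : gaspan Lam p -> piqp (T j) (gamul p f) =
  gamul (gamap (s_ j) p) (piqp (T j) f) + τ_ j *: gamul (nab j p) f.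
Proof.
move=> pL; move: p pL.
apply: gaspan_ind => [|k p p' pL p'L IHp IHp'|l lL].
- have n0 : nab j (0 : {malg F[E]}) = 0.
    have := nablaP_lin Lam_adm j (-1) (@gaspan0 F E Lam) (@gaspan0 F E Lam).
    by rewrite addr0 scaler0 scaleN1r addNr.
  by rewrite gamap0 n0 !gamul0l (rep_v0 (qp_rep piqpP)) // scaler0 addr0.
- rewrite gamul_linl (rep_linear (qp_rep piqpP) _ k (qpT _) (qpT _)) IHp IHp'.
  rewrite gamap_lin (nablaP_lin Lam_adm j k pL p'L) !gamul_linl.
  by rewrite !scalerDr !scalerA [k * _]mulrC addrACA.
have sL : Lam (s_ j l) by apply: lattice_weyl => //; exact: weyl_simple.
rewrite -(piqp_X _ lL) -(repM (qp_rep piqpP)) //.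
have /eqP := hecke_cross HT j lL; rewrite subr_eq => /eqP ->.
rewrite (repD (qp_rep piqpP)) // (repZ (qp_rep piqpP)) // (repM (qp_rep piqpP)) //.
rewrite (piqp_X _ sL) gamapU piqp_gaeval 1?addrC //.
by apply: nabla_span => //; exact: gaspanU.
Qed.

(** The bounds $-1<\alpha_j(wc)<1$ leave only the floors $0$ and $-1$, for which the quotient is $0$
    and $x^{wc}$. *)
Lemma piqp_T_orbit j w : Wc w -> piqp (T j) << w c >> =
  (if α j (w c) == 0 then q_ j else 1) *: << s_ j (w c) >> +
  (if α j (w c) < 0 then τ_ j else 0) *: << w c >>.
Proof.
move=> [wW _]; have jP : (α j \o w)%VF \in Phi by apply: weyl_root (al_root j).
have := C0_int Lam_adm c_C0 jP; have := C0_floor Lam_adm c_C0 jP.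
rewrite !comp_lfunE => fl int; rewrite (qp_T piqpP) /chi int fl; congr (_ + _).
case: ltP => _; last first.
  rewrite mulr0z subr0 subrr (gadivP (corootMn_neq0 j) (gamul0l _)).
  by rewrite scaler0 scale0r.
rewrite (gadivP (q := << w c >>) (corootMn_neq0 j)) //.
by rewrite linearBr /= gamul1r gamulUU mulrN1z opprK.
Qed.

(** The permutation of $W^c$ by which $s_j$ acts on the orbit $Wc$; if $s_j$ fixes $wc$, the
    representative stays the same. *)
Definition swap j w := if α j (w c) == 0 then w else (s_ j \o w)%VF.

Lemma swap_min j w : Wc w -> Wc (swap j w).
Proof.
by rewrite /swap => wWc; case: eqVneq => // jw; exact: min_reps_simple.
Qed.

Lemma swapE j w : swap j w c = s_ j (w c).
Proof.
rewrite /swap; case: eqVneq => [jw|_]; last by rewrite comp_lfunE.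
by apply/esym/refl_fix => //; exact: al_nz.
Qed.

Lemma al_swap j w : α j (swap j w c) = - α j (w c).
Proof. by rewrite swapE -comp_lfunE srefl_al opp_lfunE. Qed.

Lemma swapK j : involutive (swap j).
Proof.
move=> w; rewrite {1}/swap al_swap oppr_eq0 /swap.
by case: eqP => // _; exact: srefl_compKl.
Qed.

Lemma piqp_T_quasi j g : span_family g -> piqp (T j) (quasi g) =
  quasi (fun w => (if α j (w c) == 0 then q_ j else 1) *: gamap (s_ j) (g (swap j w))
    + ((if α j (w c) < 0 then τ_ j else 0) *: gamap (s_ j) (g w) + τ_ j *: nab j (g w))).
Proof.
move=> gL; pose a w : F := if α j (w c) == 0 then q_ j else 1.
pose b w : F := if α j (w c) < 0 then τ_ j else 0.
have lin (s : seq 'End(E)) (G : 'End(E) -> {malg F[E]}) :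
    piqp (T j) (\sum_(w <- s) G w) = \sum_(w <- s) piqp (T j) (G w).
  elim: s => [|w s IH]; first by rewrite !big_nil (rep_v0 (qp_rep piqpP)).
  by rewrite !big_cons -[G w]scale1r (rep_linear (qp_rep piqpP)) // IH !scale1r.
rewrite !quasiE lin.
(* Reindexing by [swap j] moves the terms at $x^{s_jwc}$ to the basis element they belong to; the
   scalar [a] is unchanged because $\alpha_j(wc)$ only changes sign. *)
have perm : \sum_(w <- Ws) gamul (a w *: gamap (s_ j) (g (swap j w))) << w c >> =
    \sum_(w <- Ws) gamul (a w *: gamap (s_ j) (g w)) << s_ j (w c) >>.
  have pm : perm_eq [seq swap j w | w <- Ws] Ws.
    apply: uniq_perm; rewrite ?map_inj_uniq ?fset_uniq //.
      exact: inv_inj (swapK j).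
    move=> w; apply/mapP/idP => [[v /mem_Ws vWc ->]|/mem_Ws wWc].
      by apply/mem_Ws; exact: swap_min.
    exists (swap j w); last by rewrite swapK.
    by apply/mem_Ws; exact: swap_min.
  rewrite -(perm_big _ pm) big_map; apply: eq_bigr => w _.
  by rewrite swapK swapE /a al_swap oppr_eq0.
under [RHS]eq_bigr do rewrite gamulDl.
rewrite [RHS]big_split /= perm -big_split; apply: eq_big_seq => w /mem_Ws wWc /=.
rewrite piqp_T_mul; last exact: gL.
by rewrite (piqp_T_orbit j wWc) gamulDr !gamulZr gamulDl !gamulZl addrA.
Qed.

End QuasiPolynomials.

(** * Solving the coefficient equations: the two mutually inverse maps *)

Section SymmetricQuasiPolynomials.
Variables (F : fieldType) (t : 'Hom(E, R^o) -> F) (Lam : set E).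
Variables (H : unitAlgType F) (T : 'I_r -> H) (X : E -> H).
Variables (pi piqp : H -> {malg F[E]} -> {malg F[E]}).
Variables (c : E) (eps : int) (w0 w0c v0 : 'End(E)).
Hypothesis t_inv : invariant_parameter dot Phi t.
Hypothesis Lam_adm : admissible_lattice dot Phi Lam.
Hypothesis HT : hecke_relations dot al Lam t T X.
Hypothesis piP : is_polynomial_rep dot al Lam t T X pi.
Hypothesis piqpP : is_quasi_polynomial_rep dot al Lam t T X piqp.
Hypothesis c_C0 : C0 dot al Phi Lam c.
Hypothesis epsE : eps = 1 \/ eps = - 1.
Hypothesis w0_longest : is_longest dot al Phi w0.
Hypothesis w0cP : min_reps dot al Phi c w0c.
Hypothesis v0P : stab dot Phi c v0.
Hypothesis w0E : w0 = (w0c \o v0)%VF.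
Implicit Types (f p : {malg F[E]}) (g h : 'End(E) -> {malg F[E]}).

Local Notation Wc := (min_reps dot al Phi c).
Local Notation q_ := (tpar al t).
Local Notation V_ := (twist_gen T eps).
Local Notation tw := (twist_elt T eps).
Local Notation e_ := (eps_eigen t eps).
Local Notation star := (star w0).
Local Notation M := (gamap (twist_map eps w0)).
Local Notation tprod := (tprod dot al t).
Local Notation span_family := (span_family Lam c).
Local Notation quasi := (quasi c).

Let c_dom i : 0 <= α i c. Proof. exact: C0_dom c_C0 i. Qed.
Let w0W : weyl w0. Proof. by case: w0_longest. Qed.
Let p0 : gaspan Lam (0 : {malg F[E]}). Proof. exact: gaspan0. Qed.
Let MK : involutive (@gamap F E (twist_map eps w0)).
Proof. exact: gamap_twistK. Qed.

Lemma tprod_neq0 w : tprod w != 0.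
Proof. by rewrite prodf_seq_neq0; apply/allP => i _; exact: tpar_neq0. Qed.

Definition J_eigen p := forall i, α i c = 0 -> pi (V_ i) p = (q_ i)^-1 *: p.

Lemma eps_J_symP p : eps_J_sym dot al Lam t T pi eps c p <->
  gaspan Lam p /\ J_eigen p.
Proof.
split=> -[pL pJ]; split=> // i ic.
  by apply/(twist_eigen_iff t_inv HT piP epsE) => //; apply/pJ/srefl_fix.
by apply/(twist_eigen_iff t_inv HT piP epsE) => //; apply/pJ/srefl_fix.
Qed.

Lemma J_eigenZ k p : gaspan Lam p -> J_eigen p -> J_eigen (k *: p).
Proof.
move=> pL pJ i ic; rewrite (rep_vZ (pol_rep piP) _ _ p0 pL) (pJ i ic).
by rewrite !scalerA mulrC.
Qed.

(** Every letter of a reduced word of $w_{0,c}$ lies in $J_c$ by [stab_word], so each factor $V_i$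
    contributes its eigenvalue $t_i^{-1}$. *)
Lemma pi_twist_stab p : gaspan Lam p -> J_eigen p ->
  pi (tw v0) p = (tprod v0)^-1 *: p.
Proof.
move=> pL pJ; have [v0W v0c] := v0P.
have Tp : pi (Tw dot al T v0) p = (\prod_(i <- red_word v0) e_ i) *: p.
  apply: (rep_eigen_prod (pol_rep piP)) => // i iv.
  apply/(twist_eigen_iff t_inv HT piP epsE) => //; apply: pJ.
  by apply: (stab_word c_dom (s := red_word v0)); rewrite ?red_wordK.
rewrite /twist_elt; move: Tp; case: eqP => eps1 Tp.
  (* As $w_{0,c}$ is an involution, [Tw] is evaluated at [v0] itself. *)
  rewrite (longest_stabV w0_longest c_dom w0cP v0P w0E).
  apply: (canRL (scalerK (tprod_neq0 v0))).
  rewrite -(rep_vZ (pol_rep piP) _ _ p0 pL).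
  have -> : tprod v0 *: p = pi (Tw dot al T v0) p.
    rewrite Tp; congr (_ *: _); apply: eq_bigr => i _.
    by rewrite eps_eigenE // eps1.
  rewrite -(repM (pol_rep piP) _ _ pL) (mulVr (Tw_unit t_inv HT _)).
  exact: (rep1 (pol_rep piP) pL).
rewrite (repZ (pol_rep piP) _ _ pL) Tp scalerA; congr (_ *: _).
rewrite /tprod -prodfV /len; elim: (red_word v0) => [|i s IH].
  by rewrite !big_nil mulr1.
rewrite !big_cons -IH eps_eigenE // (introF eqP eps1) /= exprS.
ring.
Qed.

(** From $w_0s_j=s_{j'}w_0$ one gets $w_0w=s_{j'}(w_0s_jw)$, and $\alpha_j(wc)>0$ makes this product
    increase the length. *)
Lemma twist_step j w : Wc w -> 0 < α j (w c) ->
  tw (w0 \o w)%VF = V_ (star j) * tw (w0 \o (s_ j \o w))%VF.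
Proof.
move=> [wW _] jw; have sW := weyl_simple j.
have jP : (α j \o w)%VF \in Phi by apply: weyl_root (al_root j).
rewrite -(twist_mull t_inv HT).
- by rewrite !comp_lfunA -longest_srefl // -(comp_lfunA w0) srefl_compK comp_lfun1r.
- by apply: weylM => //; exact: weylM.
rewrite !comp_lfunA (starP w0_longest) (starK w0_longest) comp_lfunNl srefl_al opprK.
by apply: (dom_gt0_posr c_dom jP); rewrite comp_lfunE.
Qed.

(** With $s_jw=ws_i$, the element $u=w_0s_jw$ satisfies $w_0w=s_{j'}u=us_i$, both products
    increasing the length. Hence both sides equal $V_{j'}V_uV_i$. *)
Lemma twist_commute j w : Wc w -> α j (w c) = 0 -> exists i,
  [/\ α i c = 0, q_ i = q_ j & V_ (star j) * tw (w0 \o w)%VF = tw (w0 \o w)%VF * V_ i].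
Proof.
move=> wWc jw; have [wW _] := wWc; have sW := weyl_simple j.
have [i ic ji] := min_reps_fix c_dom wWc jw; exists i; split=> //.
  exact: (tpar_conj t_inv wW ji).
have siW := weyl_simple i; have wi := srefl_weyl_comp wW ji.
set u := (w0 \o (s_ j \o w))%VF; have uW : weyl u by apply: weylM => //; exact: weylM.
have eL : tw (w0 \o w)%VF = V_ (star j) * tw u.
  rewrite -(twist_mull t_inv HT) //.
    by rewrite /u !comp_lfunA -longest_srefl // -(comp_lfunA w0) srefl_compK comp_lfun1r.
  rewrite /u !comp_lfunA (starP w0_longest) (starK w0_longest) comp_lfunNl srefl_al.
  by rewrite opprK ji posr_al.
have eR : tw (w0 \o w)%VF = tw u * V_ i.
  rewrite -(twist_mulr t_inv HT) //.
    by rewrite /u wi -!comp_lfunA srefl_compK comp_lfun1r.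
  rewrite /u wi !weylMV ?(longestV w0_longest) ?simpleV //; last exact: weylM.
  rewrite !comp_lfunA srefl_al !comp_lfunNl -ji -(comp_lfunA (α j)) weyl_compfV //.
  by rewrite comp_lfun1r (starP w0_longest) opprK posr_al.
by rewrite {2}eL eR mulrA.
Qed.

(** The negative case is the positive case at $s_jw$, written from the other end. *)
Definition twisted h j w :=
  if α j (w c) == 0 then pi (V_ (star j)) (h w) = (q_ j)^-1 *: h w
  else if α j (w c) < 0 then h (s_ j \o w)%VF = pi (V_ (star j)) (h w)
  else h w = pi (V_ (star j)) (h (s_ j \o w)%VF).

Lemma eq_twisted h h' j w : h =1 h' -> twisted h' j w -> twisted h j w.
Proof. by move=> hh'; rewrite /twisted !hh'. Qed.

(** Freeness allows comparison of coefficients at each $x^{wc}$; the sign of $\alpha_j(wc)$ then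
    selects one of the three transport equivalences. *)
Lemma quasi_eigen_twisted g : span_family g ->
  (forall j, piqp (T j) (quasi g) = e_ j *: quasi g) <->
  (forall j w, Wc w -> twisted (fun w => M (g w)) j w).
Proof.
move=> gL.
have eq j w : Wc w -> ((if α j (w c) == 0 then q_ j else 1) *:
      gamap (s_ j) (g (swap c j w)) + ((if α j (w c) < 0 then q_ j - (q_ j)^-1 else 0) *:
      gamap (s_ j) (g w) + (q_ j - (q_ j)^-1) *: nabla dot al j (g w)) = e_ j *: g w) <->
    twisted (fun w => M (g w)) j w.
  move=> wWc; have gwL := gL w wWc; have gsL := gL _ (swap_min c_C0 j wWc).
  move: gsL; rewrite /twisted /swap; case: eqVneq => [jw gsL|jw gsL].
    rewrite jw ltxx scale0r add0r.
    exact: (twist_zero_iff t_inv HT Lam_adm piP epsE w0_longest j gwL).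
  rewrite scale1r; case: ifP => _.
    rewrite -scalerDr.
    exact: (twist_neg_iff t_inv HT Lam_adm piP epsE w0_longest j _ gwL).
  rewrite scale0r add0r.
  exact: (twist_pos_iff t_inv HT Lam_adm piP epsE w0_longest j gwL gsL).
have scal j : e_ j *: quasi g = quasi (fun w => e_ j *: g w).
  rewrite !(quasiE c w0_longest) scaler_sumr; apply: eq_bigr => w _.
  by rewrite gamulZl.
split=> [gT j w wWc|gT j].
  apply/(eq j w wWc); move: (gT j).
  rewrite (piqp_T_quasi Lam_adm c_C0 w0_longest HT piqpP j gL) scal.
  move=> /(quasi_inj Lam_adm c_C0 w0_longest) h; apply: h wWc => v vWc.
    have gvL := gL v vWc; have gsL := gL _ (swap_min c_C0 j vWc).
    apply: gaspanD; first exact (gaspanZ (srefl_span Lam_adm gsL)).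
    apply: gaspanD; first exact (gaspanZ (srefl_span Lam_adm gvL)).
    exact (gaspanZ (nabla_span Lam_adm gvL)).
  exact (gaspanZ (gL v vWc)).
rewrite (piqp_T_quasi Lam_adm c_C0 w0_longest HT piqpP j gL) scal.
by apply: (eq_quasi w0_longest) => w wWc; apply/(eq j w wWc); exact: gT.
Qed.

(** Induction on $l(w_0)-l(w)$: if some $\alpha_j(wc)>0$, then $h_w$ is determined by the longer
    $s_jw$. Otherwise $w=w_0^c$, where $t(w_{0,c})$ cancels the action of $V_{w_{0,c}}$. *)
Lemma twisted_solution h w : (forall w, Wc w -> gaspan Lam (h w)) ->
  (forall j w, Wc w -> twisted h j w) -> J_eigen (h w0c) /\
  (Wc w -> h w = tprod v0 *: pi (tw (w0 \o w)%VF) (h w0c)).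
Proof.
move=> hL hT; have v0W : weyl v0 by case: v0P.
have hJ : J_eigen (h w0c).
  move=> i ic; have jc : α (star i) (w0c c) = 0.
    exact/(longest_comp_fix w0_longest v0P w0E).
  have := hT (star i) w0c w0cP; rewrite /twisted jc eqxx (starK w0_longest).
  by rewrite (tpar_star t_inv w0_longest).
split=> //; have [n] := ubnP (len w0 - len w); elim: n w => // n IH w wn wWc.
have [wW _] := wWc.
have [[j jw]|nj] := pselect (exists j, 0 < α j (w c)); last first.
  have -> : w = w0c.
    apply: (min_reps_max w0_longest c_dom w0cP v0P w0E wWc) => j.
    by rewrite leNgt; apply/negP => jw; apply: nj; exists j.
  rewrite (longest_compl w0_longest c_dom w0cP v0P w0E) pi_twist_stab //; last exact: hL.
  by rewrite scalerA divff ?tprod_neq0 // scale1r.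
have jP : (α j \o w)%VF \in Phi by apply: weyl_root (al_root j).
have pj : posr (α j \o w)%VF by apply: (dom_gt0_posr c_dom jP); rewrite comp_lfunE.
have jw0 : α j (w c) != 0 by rewrite gt_eqF.
have swWc := min_reps_simple c_dom wWc jw0; have [swW _] := swWc.
have := hT j w wWc; rewrite /twisted (negPf jw0) ltNge (ltW jw) /= => ->.
have := len_asc wW pj; have [_ /(_ _ swW)] := w0_longest => lw ls.
rewrite IH // ?(twist_step wWc jw); last by lia.
rewrite (repM (pol_rep piP) _ _ (hL _ w0cP)) (rep_vZ (pol_rep piP) _ _ p0) //.
by apply: (pi_span piP); exact: hL.
Qed.

Lemma twisted_orbit p : gaspan Lam p -> J_eigen p ->
  forall j w, Wc w -> twisted (fun w => tprod w0 *: pi (tw (w0 \o w)%VF) p) j w.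
Proof.
move=> pL pJ j w wWc; rewrite /twisted.
have act u : pi (V_ (star j)) (tprod w0 *: pi (tw u) p) =
    tprod w0 *: pi (V_ (star j) * tw u) p.
  rewrite (rep_vZ (pol_rep piP) _ _ p0 (pi_span piP pL)).
  by rewrite (repM (pol_rep piP) _ _ pL).
case: eqVneq => [jw|jw0].
  have [i [ic ij comm]] := twist_commute wWc jw.
  rewrite act comm (repM (pol_rep piP) _ _ pL) (pJ i ic).
  by rewrite (rep_vZ (pol_rep piP) _ _ p0 pL) ij !scalerA mulrC.
have swWc := min_reps_simple c_dom wWc jw0.
rewrite !act; case: ltP => jw.
  have jsw : 0 < α j ((s_ j \o w)%VF c).
    by rewrite comp_lfunE -comp_lfunE srefl_al opp_lfunE oppr_gt0.
  by rewrite (twist_step swWc jsw) srefl_compKl.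
have jw1 : 0 < α j (w c) by rewrite lt_def jw0.
by rewrite (twist_step wWc jw1).
Qed.

Definition sym_to_poly f : {malg F[E]} :=
  (tprod v0 / tprod w0) *: M (gamma_qp dot Phi al Lam c f w0c).

(** Since $M$ is an involution, applying it to the solution $h_w$ recovers the coefficients $g_w$;
    both signs of $\epsilon$ are covered at once. *)
Definition poly_to_sym p : {malg F[E]} :=
  quasi (fun w => M (tprod w0 *: pi (tw (w0 \o w)%VF) p)).

Local Notation Sym := (eps_sym dot Phi al Lam t T piqp eps c).
Local Notation JSym := (eps_J_sym dot al Lam t T pi eps c).

Let poly_family p : gaspan Lam p ->
  span_family (fun w => M (tprod w0 *: pi (tw (w0 \o w)%VF) p)).
Proof.
move=> pL w _; apply: (gamap_twist_span Lam_adm w0_longest); apply: gaspanZ.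
exact: (pi_span piP pL).
Qed.

Lemma poly_to_sym_Sym p : JSym p -> Sym (poly_to_sym p).
Proof.
move=> /eps_J_symP[pL pJ]; split; first exact: (quasi_span w0_longest (poly_family pL)).
apply/(quasi_eigen_twisted (poly_family pL)) => j w wWc.
apply: (eq_twisted (h' := fun w => tprod w0 *: pi (tw (w0 \o w)%VF) p)) => [v|].
  exact: MK.
exact: twisted_orbit.
Qed.

Let Sym_twisted f : Sym f -> let g := gamma_qp dot Phi al Lam c f in
  [/\ f = quasi g, span_family g & forall j w, Wc w -> twisted (fun w => M (g w)) j w].
Proof.
move=> [fO fT] g; have [gL fE] := gamma_qpP w0_longest fO.
by split=> //; apply/quasi_eigen_twisted => //; rewrite -fE.
Qed.

Lemma sym_to_poly_JSym f : Sym f -> JSym (sym_to_poly f).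
Proof.
move=> /Sym_twisted[_ gL gT].
have MgL w : Wc w -> gaspan Lam (M (gamma_qp dot Phi al Lam c f w)).
  by move=> wWc; apply: (gamap_twist_span Lam_adm w0_longest); exact: gL.
apply/eps_J_symP; split; first by apply: gaspanZ; exact: MgL.
apply: J_eigenZ; first exact: MgL.
by have [] := twisted_solution w0c MgL gT.
Qed.

Lemma sym_to_polyK f : Sym f -> poly_to_sym (sym_to_poly f) = f.
Proof.
move=> /Sym_twisted[fE gL gT]; rewrite [RHS]fE /poly_to_sym.
have MgL w : Wc w -> gaspan Lam (M (gamma_qp dot Phi al Lam c f w)).
  by move=> wWc; apply: (gamap_twist_span Lam_adm w0_longest); exact: gL.
apply: (eq_quasi w0_longest) => w wWc; rewrite /sym_to_poly.
rewrite (rep_vZ (pol_rep piP) _ _ p0 (MgL _ w0cP)) scalerA mulrC divfK ?tprod_neq0 //.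
by have [_ <-//] := twisted_solution w MgL gT.
Qed.

Lemma poly_to_symK p : JSym p -> sym_to_poly (poly_to_sym p) = p.
Proof.
move=> /eps_J_symP[pL pJ]; rewrite /sym_to_poly.
rewrite (gamma_qp_quasi Lam_adm c_C0 w0_longest (poly_family pL)) // MK.
rewrite (longest_compl w0_longest c_dom w0cP v0P w0E) pi_twist_stab //.
by rewrite !scalerA divfK ?tprod_neq0 // divff ?tprod_neq0 // scale1r.
Qed.

End SymmetricQuasiPolynomials.

End Roots.

Theorem corollary7p5
  (R : realType) (E : vectType R) (dot : {dot E for @idfun R})
  (Phi : {fset 'Hom(E, R^o)}) (r : nat) (al : r.-tuple 'Hom(E, R^o))
  (F : fieldType) (t : 'Hom(E, R^o) -> F) (Lam : set E)
  (H : unitAlgType F) (T : 'I_r -> H) (X : E -> H)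
  (pi piqp : H -> {malg F[E]} -> {malg F[E]})
  (c : E) (eps : int) (w0 w0c w0_c : 'End(E)) :
  irreducible_reduced_root_system dot Phi ->
  is_base al Phi ->
  invariant_parameter dot Phi t ->
  admissible_lattice dot Phi Lam ->
  is_affine_hecke dot al Lam t T X ->
  is_polynomial_rep dot al Lam t T X pi ->
  is_quasi_polynomial_rep dot al Lam t T X piqp ->
  C0 dot al Phi Lam c ->
  eps = 1 \/ eps = - 1 ->
  is_longest dot al Phi w0 ->
  min_reps dot al Phi c w0c ->
  stab dot Phi c w0_c ->
  w0 = (w0c \o w0_c)%VF ->
  let Wc := min_reps dot al Phi c in
  let len := len dot al in
  let Tw := Tw dot al T in
  let t_ w := tprod dot al t w in
  let Sym := eps_sym dot Phi al Lam t T piqp eps c in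
  let JSym := eps_J_sym dot al Lam t T pi eps c in
  let phi f :=
    let g := gamap w0 (gamma_qp dot Phi al Lam c f w0c) in
    (t_ w0_c / t_ w0) *: (if eps == 1 then g else iota_ga g) in
  let psi p :=
    t_ w0 *:
    (if eps == 1 then
       \sum_(w \in Wc)
         gamul (gamap w0 (pi (Tw ((w0 \o w)^-1)%VF)^-1 p)) << w c >>
     else
       \sum_(w \in Wc)
         gamul ((-1) ^+ (len w0 + len w) *:
                iota_ga (gamap w0 (pi (Tw (w0 \o w)%VF) p))) << w c >>) in
  set_bij Sym JSym phi /\
  [/\ forall p, JSym p -> Sym (psi p),
      forall f, Sym f -> psi (phi f) = f &
      forall p, JSym p -> phi (psi p) = p].
Proof.
move=> PhiP alP tP LamP [HT _] piP piqpP cP epsE w0P w0cP v0P w0E.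
move=> Wc len Tw t_ Sym JSym phi psi; have [w0W _] := w0P.
have phiE f : phi f = sym_to_poly dot Phi al t Lam c eps w0 w0c w0_c f.
  rewrite /phi /sym_to_poly /twist_map; congr (_ *: _); case: eqP => // _.
  by rewrite /iota_ga gamap_comp; apply: eq_gamap => y /=; rewrite opp_lfunE.
(* The argument must lie in $F[\Lambda]$, because for $\epsilon=-1$ the sign in [twist_elt] is moved
   out of [pi]. *)
have psiE p : JSym p -> psi p = poly_to_sym dot Phi al t T pi c eps w0 p.
  move=> [pL _]; pose G w : {malg F[E]} :=
    if eps == 1 then gamap w0 (pi (Tw ((w0 \o w)^-1)%VF)^-1 p)
    else (-1) ^+ (len w0 + len w) *: iota_ga (gamap w0 (pi (Tw (w0 \o w)%VF) p)).
  have -> : psi p = t_ w0 *: quasi dot Phi al c G.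
    by rewrite /psi /quasi /G; case: ifP.
  have -> : t_ w0 *: quasi dot Phi al c G = quasi dot Phi al c (fun w => t_ w0 *: G w).
    rewrite !(quasiE PhiP alP c w0P) scaler_sumr; apply: eq_bigr => w _.
    by rewrite gamulZl.
  apply: (eq_quasi PhiP alP w0P) => w [wW _].
  have gZ (h : E -> E) k (f : {malg F[E]}) : gamap h (k *: f) = k *: gamap h f.
    exact: linearZ.
  rewrite gZ /G /twist_map /twist_elt; case: eqP => [//|_].
  rewrite (repZ (pol_rep piP) _ _ pL) gZ; congr (_ *: (_ *: _)).
    (* Lengths do not add up in $w_0w$, but their parities do. *)
    by rewrite -signr_odd oddD -(odd_lenM PhiP alP w0W wW) signr_odd.
  by rewrite /iota_ga gamap_comp; apply: eq_gamap => y /=; rewrite opp_lfunE.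
have symJ f : Sym f -> JSym (phi f).
  move=> fS; rewrite phiE.
  exact (sym_to_poly_JSym PhiP alP tP LamP HT piP piqpP cP epsE w0P w0cP v0P w0E fS).
have Jsym p : JSym p -> Sym (psi p).
  move=> pJ; rewrite psiE //.
  exact (poly_to_sym_Sym PhiP alP tP LamP HT piP piqpP cP epsE w0P pJ).
have phiK f : Sym f -> psi (phi f) = f.
  move=> fS; rewrite (psiE _ (symJ f fS)) phiE.
  exact (sym_to_polyK PhiP alP tP LamP HT piP piqpP cP epsE w0P w0cP v0P w0E fS).
have psiK p : JSym p -> phi (psi p) = p.
  move=> pJ; rewrite phiE psiE //.
  exact (poly_to_symK PhiP alP tP LamP HT piP cP epsE w0P w0cP v0P w0E pJ).
split; last by split.
split=> [f|f f' /set_mem fS /set_mem fS' ff'|p pJ]; first exact: symJ.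
  by rewrite -(phiK f fS) -(phiK f' fS') ff'.
by exists (psi p); [exact: Jsym|exact: psiK].
Qed.
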